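(* Let $n\ge 1$, $0<\alpha<n$ and $0<q<\infty$, and let $\sigma$ be a weak $A_\infty$ weight on $\mathbf{R}^n$. Then there exist finite positive constants $C,c>0$, depending only on $n$, $q$, $\alpha$ and the weak $A_\infty$ character of $\sigma$, such that for every nonnegative measure $\mu$ on $\mathbf{R}^n$, $$\frac{1}{|2B|_\sigma}\int_{2B}\exp\left(\Bigl(c\,\frac{\mathbf{T}^q_\alpha(\mu_B)(x)}{\|\mathbf{M}_\alpha(\mu_B)\|_{L^\infty(B)}}\Bigr)^q\right)d\sigma(x)\le C$$ for all balls $B\subset\mathbf{R}^n$ such that $\|\mathbf{M}_\alpha(\mu_B)\|_{L^\infty(B)}<\infty$.
   Context: For a nonnegative (Borel) measure $\mu$ on $\mathbf{R}^n$, $0<\alpha<n$ and $0<q<\infty$, the nonlinear potential is $$\mathbf{T}^q_\alpha(\mu)(x)=\Bigl(\int_0^\infty\Bigl(\frac{\mu(B(x,r))}{r^{n-\alpha}}\Bigr)^q\frac{dr}{r}\Bigr)^{1/q},$$ and the fractional maximal operator is $\mathbf{M}_\alpha(\mu)(x)=\sup_{r>0}\mu(B(x,r))\,r^{\alpha-n}$, where $B(x,r)$ is the ball with center $x$ and radius $r$. For a set $E$, $\mu_E$ denotes the restriction $d\mu_E=\chi_E\,d\mu$. For a ball $B$ (or cube), $2B$ is its concentric double. A nonnegative measurable function $\sigma$ on $\mathbf{R}^n$ is a weak $A_\infty$ weight if there exist constants $C_\sigma>0$ and $\theta>0$ such that for each cube $Q$ and each measurable set $E\subset Q$, $$\frac{|E|_\sigma}{|2Q|_\sigma}\le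 C_\sigma\Bigl(\frac{|E|}{|Q|}\Bigr)^\theta$$ (i.e. $|E|_\sigma\le C_\sigma(|E|/|Q|)^\theta|2Q|_\sigma$), where $|E|$ is Lebesgue measure, $|E|_\sigma=\int_E\sigma\,dx$ and $d\sigma=\sigma\,dx$. A constant depends on the weak $A_\infty$ character of $\sigma$ if it depends on $\theta$ and $C_\sigma$. *)

(* Defs.v *)
From HB Require Import structures.
From mathcomp Require Import all_boot all_order all_algebra.
From mathcomp Require Import all_classical all_reals all_analysis.
From mathcomp Require Import measurable_realfun.

Set Implicit Arguments.
Unset Strict Implicit.
Unset Printing Implicit Defensive.
Import Order.TTheory GRing.Theory Num.Def Num.Theory.
Import numFieldNormedType.Exports.

Local Open Scope classical_set_scope.
Local Open Scope ring_scope.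

(* n.-tuple R carries the sigma-algebra generated by the coordinate maps, that
   is, the Borel sigma-algebra of R^n. *)
Notation Rn R n := (n.-tuple R%type).

Section lebesgue_step.
Variable R : realType.
Local Open Scope ereal_scope.

Definition tcons n (p : measurableTypeR R * Rn R n) : Rn R n.+1 := [tuple of p.1 :: p.2].

Definition tuncons n (t : Rn R n.+1) : measurableTypeR R * Rn R n :=
  (thead t, [tuple of behead t]).

Lemma measurable_tcons n : measurable_fun setT (@tcons n).
Proof.
exact: (@measurable_cons _ _ (measurableTypeR R * Rn R n)%type R fst n snd
  measurable_fst measurable_snd).
Qed.

Lemma measurable_tuncons n : measurable_fun setT (@tuncons n).
Proof.
apply/measurable_fun_pairP; split; first exact: measurable_tnth.
exact: measurable_behead.
Qed.

Lemma tconsK n : cancel (@tcons n) (@tuncons n).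
Proof. by move=> [x t]; congr pair; apply/val_inj. Qed.

Variables (n : nat) (m : {sigma_finite_measure set (Rn R n) -> \bar R}).

Definition lebesgue_step : set (Rn R n.+1) -> \bar R :=
  pushforward (lebesgue_measure \x m) (@tcons n).

Let step0 : lebesgue_step set0 = 0.
Proof. by rewrite /lebesgue_step /pushforward preimage_set0 measure0. Qed.

Let step_ge0 A : 0 <= lebesgue_step A.
Proof. by rewrite /lebesgue_step /pushforward measure_ge0. Qed.

Let mpreim A : measurable A -> measurable (@tcons n @^-1` A).
Proof. by move=> mA; rewrite -[X in measurable X]setTI; exact: measurable_tcons. Qed.

Let step_sigma_additive : semi_sigma_additive lebesgue_step.
Proof.
move=> F mF tF mUF; rewrite /lebesgue_step /pushforward preimage_bigcup.
apply: measure_semi_sigma_additive.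
- by move=> k; exact: mpreim.
- apply/trivIsetP => /= i j _ _ ij; rewrite -preimage_setI.
  by move/trivIsetP : tF => /(_ _ _ _ _ ij) ->//; rewrite preimage_set0.
- by rewrite -preimage_bigcup; exact: mpreim.
Qed.

HB.instance Definition _ := isMeasure.Build _ _ _ lebesgue_step
  step0 step_ge0 step_sigma_additive.

Let step_sigma_finite : sigma_finite setT lebesgue_step.
Proof.
have /sigma_finiteP[F [TF ndF Foo]] := sigma_finiteT (@lebesgue_measure R).
have /sigma_finiteP[G [TG ndG Goo]] := sigma_finiteT m.
exists (fun i => @tuncons n @^-1` (F i `*` G i)).
  rewrite -preimage_bigcup (_ : \bigcup_i _ = setT) ?preimage_setT//.
  rewrite -setXTT TF TG predeqE => -[x y]; split.
    by move=> [k _ []/= ? ?]; split; exists k.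
  move=> [/= [i _ Fnx] [k _ Gky]]; exists (maxn i k) => //; split.
  - by move: x Fnx; exact/subsetPset/ndF/leq_maxl.
  - by move: y Gky; exact/subsetPset/ndG/leq_maxr.
move=> k; have [? ?] := Foo k; have [? ?] := Goo k.
split.
  rewrite -[X in measurable X]setTI; apply: measurable_tuncons => //.
  exact: measurableX.
rewrite /lebesgue_step /pushforward.
rewrite (_ : @tcons n @^-1` _ = F k `*` G k); last first.
  by apply/funext => p; rewrite /preimage /mkset tconsK.
by rewrite product_measure1E// lte_mul_pinfty// ge0_fin_numE.
Qed.

HB.instance Definition _ := Measure_isSigmaFinite.Build _ _ _ lebesgue_step
  step_sigma_finite.

End lebesgue_step.

Section lebesgue_Rn.
Variable R : realType.
Local Open Scope ereal_scope.

(* Lebesgue measure on the Borel sets of R^n, as an iterated product of the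
   one-dimensional Lebesgue measure. *)
Fixpoint borel_lebesgue n : {sigma_finite_measure set (Rn R n) -> \bar R} :=
  match n with
  | 0%N => \d_([tuple] : Rn R 0)
  | k.+1 => lebesgue_step (borel_lebesgue k)
  end.

(* R^n with the sigma-algebra of its Lebesgue measurable sets. *)
Definition LRn n := caratheodory_type (mu_ext (borel_lebesgue n)).

Definition lebesgue_Rn n : set (LRn n) -> \bar R :=
  @completed_measure_extension _ _ _ (borel_lebesgue n).

HB.instance Definition _ n := Measure.on (@lebesgue_Rn n).

Definition box n (a b : 'I_n -> R) : set (Rn R n) :=
  [set x | forall i, (a i <= tnth x i <= b i)%R].

Lemma measurable_box n (a b : 'I_n -> R) : measurable (box a b).
Proof.
rewrite (_ : box a b =
    \big[setI/setT]_(i < n) (fun x : Rn R n => tnth x i) @^-1` `[a i, b i]).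
  apply: bigsetI_measurable => i _; rewrite -[X in measurable X]setTI.
  exact: measurable_tnth.
rewrite -bigcap_seq; apply/seteqP; split => x /= H i.
  by move=> _ /=; rewrite in_itv/=; exact: H.
by have := H i (mem_index_enum i); rewrite /= in_itv.
Qed.

Lemma borel_lebesgue_box n (a b : 'I_n -> R) : (forall i, a i <= b i)%R ->
  borel_lebesgue n (box a b) = (\prod_(i < n) (b i - a i))%:E.
Proof.
elim: n a b => [|n IH] a b ab.
  rewrite big_ord0 /= diracE mem_set//.
  by move=> -[].
rewrite big_ord_recl EFinM -(IH (a \o lift ord0) (b \o lift ord0)); last first.
  by move=> i; exact: ab.
rewrite /= /lebesgue_step /pushforward.
rewrite (_ : _ @^-1` _ = `[a ord0, b ord0]%classic `*`
    box (a \o lift ord0) (b \o lift ord0)); last first.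
  apply/seteqP; split => -[x t] /=.
    move=> H; split; first by have := H ord0; rewrite in_itv.
    by move=> i /=; have := H (lift ord0 i); rewrite tnthS.
  move=> [/= x0 tb] i; have [j ->|->] := unliftP ord0 i.
    by rewrite tnthS; exact: tb.
  by rewrite in_itv in x0.
rewrite product_measure1E//; last exact: measurable_box.
congr (_ * _); rewrite [LHS]lebesgue_measure_itv/= lte_fin EFinB.
by have := ab ord0; rewrite le_eqVlt => /predU1P[->|->//]; rewrite ltxx subee.
Qed.

Lemma lebesgue_Rn_box n (a b : 'I_n -> R) : (forall i, a i <= b i)%R ->
  lebesgue_Rn (box a b) = (\prod_(i < n) (b i - a i))%:E.
Proof.
move=> ab; rewrite -borel_lebesgue_box// /lebesgue_Rn.
by apply: measurable_mu_extE; exact: measurable_box.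
Qed.

End lebesgue_Rn.

Section potentials.
Variables (R : realType) (n : nat).
Local Open Scope ereal_scope.

(* Open Euclidean ball; the double of eball x r is eball x (2 * r). *)
Definition eball (x : Rn R n) (r : R) : set (Rn R n) :=
  [set y | (Num.sqrt (\sum_(i < n) (tnth y i - tnth x i) ^+ 2) < r)%R].

Lemma measurable_eball x r : measurable (eball x r).
Proof.
rewrite -[X in measurable X]setTI.
have -> : eball x r = (fun y : Rn R n =>
    Num.sqrt (\sum_(i < n) (tnth y i - tnth x i) ^+ 2))%R @^-1` `]-oo, r[.
  by apply/seteqP; split => y /=; rewrite in_itv.
apply: measurableT_comp => //.
  by apply: continuous_measurable_fun; exact: sqrt_continuous.
apply: measurable_sum => i; apply: measurable_funX.
by apply: measurable_funB => //; exact: measurable_tnth.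
Qed.

(* Closed axis-parallel cube with center x and side length l; its concentric
   double is cube x (2 * l). *)
Definition cube (x : Rn R n) (l : R) : set (Rn R n) :=
  [set y | forall i, (`|tnth y i - tnth x i| <= l / 2)%R].

(* Values in [0, +oo]. In \bar R, 0 / 0 = 0 * +oo = 0: a quotient of potT nu by a
   norm of maxM nu is 0 when nu vanishes. *)
Definition potT (alpha q : R) (nu : {measure set (Rn R n) -> \bar R})
    (x : Rn R n) : \bar R :=
  (\int[lebesgue_measure]_(r in `]0%R, +oo[)
     ((nu (eball x r) / (r `^ (n%:R - alpha))%:E) `^ q * (r^-1)%:E)) `^ q^-1.

Definition maxM (alpha : R) (nu : {measure set (Rn R n) -> \bar R})
    (x : Rn R n) : \bar R :=
  ereal_sup [set nu (eball x r) * (r `^ (alpha - n%:R))%:E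
            | r in [set r : R | (0 < r)%R]].

(* |E|_sigma, the value on E of the measure with density sigma. *)
Definition wmeas (sigma : LRn R n -> \bar R) (E : set (LRn R n)) : \bar R :=
  \int[@lebesgue_Rn R n]_(x in E) sigma x.

(* (Cs, theta) is the weak A_infty character of sigma. As usual for weights,
   sigma may take the value +oo. *)
Definition weak_Ainfty (Cs theta : R) (sigma : LRn R n -> \bar R) : Prop :=
  [/\ measurable_fun setT sigma, (forall x, 0 <= sigma x) &
      forall (x : Rn R n) (l : R) (E : set (LRn R n)), (0 < l)%R ->
        measurable E -> E `<=` cube x l ->
        wmeas sigma E <=
          Cs%:E * (lebesgue_Rn E / lebesgue_Rn (cube x l : set (LRn R n))) `^ theta
            * wmeas sigma (cube x (2 * l))].

End potentials.

(* Main.v *)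
(* Write nu for mu restricted to B and N for the norm of M_alpha(nu) on B. Since M_alpha(nu) <= N
   almost everywhere on B, every set of diameter D has nu-mass at most C N D^(n - alpha). Hence
   (T(nu) / N)^q is bounded by a constant plus the sum over k >= 1 of a_k, where
   a_k(x) = (nu(Q') / (N l(Q)^(n - alpha)))^q for the cube Q of side l(Q) = s 2^-k containing x in a
   grid of mesh s comparable to the radius of B, Q' being the union of Q and its neighbours. These
   a_k are bounded, so exp(b sum a_k) is at most the product of the 1 + c a_k.

   By Chebyshev's inequality, inside a cube R of generation m the function a_(m+i) exceeds
   2^(-i alpha q / 2) only on a set of relative Lebesgue measure O(2^(-i alpha / 2)); with the
   A_infty inequality this bounds the integral of sum_i a_(m+i) over R with respect to sigma by
   C sigma(R'). Expanding the product according to its coarsest factor different from 1 and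
   inducting from the finest scale upwards, the integral over Q of the product of the 1 + c a_j over
   the scales j finer than that of Q is at most 2 sigma(Q') as soon as c is small. *)
Require Import Defs.
From HB Require Import structures.
From mathcomp Require Import all_boot all_order all_algebra.
From mathcomp Require Import all_classical all_reals all_analysis.
From mathcomp Require Import measurable_realfun ess_sup_inf zify ring lra.

Set Implicit Arguments.
Unset Strict Implicit.
Unset Printing Implicit Defensive.
Import Order.TTheory GRing.Theory Num.Theory.
Import numFieldNormedType.Exports.
Local Open Scope classical_set_scope.
Local Open Scope ring_scope.

(** * Sums of nonnegative extended reals over arbitrary index sets *)

Section esum_complements.
Local Open Scope ereal_scope.
Context {R : realType}.

Lemma subset_le_esum (T : choiceType) (A B : set T) (a : T -> \bar R) :
  A `<=` B -> \esum_(i in A) a i <= \esum_(i in B) a i.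
Proof.
move=> AB; apply: ereal_sup_le => _ [X [finX XA] <-].
by exists X => //; split => //; exact: subset_trans AB.
Qed.

Lemma esumZl_le (T : choiceType) (A : set T) (c : R) (a : T -> \bar R) :
  (0 <= c)%R -> (forall i, 0 <= a i) ->
  \esum_(i in A) (c%:E * a i) <= c%:E * \esum_(i in A) a i.
Proof.
move=> c0 a0; apply: ge_ereal_sup => _ [X [finX XA] <-].
rewrite -ge0_mule_fsumr//.
apply: lee_wpmul2l; first by rewrite lee_fin.
by apply: ereal_sup_ubound; exists X.
Qed.

Lemma esumZl_ge (T : choiceType) (A : set T) (c : R) (a : T -> \bar R) :
  (0 <= c)%R -> (forall i, 0 <= a i) ->
  c%:E * (\esum_(i in A) a i) <= \esum_(i in A) (c%:E * a i).
Proof.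
rewrite le_eqVlt => /predU1P[<- a0|c0 a0].
  by rewrite mul0e; apply: esum_ge0 => i _; rewrite mul0e.
rewrite -lee_pdivlMl//; apply: le_trans; last first.
  apply: esumZl_le => [|i]; first by rewrite invr_ge0 ltW.
  by apply: mule_ge0 => //; rewrite lee_fin ltW.
by apply: le_esum => i _; rewrite muleA -EFinM mulVf ?gt_eqF// mul1e.
Qed.

Lemma esumZl (T : choiceType) (A : set T) (c : R) (a : T -> \bar R) :
  (0 <= c)%R -> (forall i, 0 <= a i) ->
  \esum_(i in A) (c%:E * a i) = c%:E * \esum_(i in A) a i.
Proof. by move=> c0 a0; apply/eqP; rewrite eq_le esumZl_le ?esumZl_ge. Qed.

Lemma esum_preimage (T U : choiceType) (f : T -> U) (A : set U) (a : T -> \bar R) :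
  (forall i, 0 <= a i) ->
  \esum_(i in f @^-1` A) a i = \esum_(j in A) \esum_(i in f @^-1` [set j]) a i.
Proof.
move=> a0; rewrite esum_esum//.
rewrite (reindex_esum (f @^-1` A) (A `*`` (fun j => f @^-1` [set j]))
  (fun i => (f i, i)))//; split.
- by move=> i /= Afi; split.
- by move=> i j _ _ [].
- move=> [j i] /= [Aj fij]; by exists i; rewrite /= fij.
Qed.

Lemma esum_exchange (T U : choiceType) (A : set T) (J : T -> set U)
    (B : set U) (K : U -> set T) (a : T -> U -> \bar R) :
  (forall i j, 0 <= a i j) ->
  (forall i j, (A i /\ J i j) <-> (B j /\ K j i)) ->
  \esum_(i in A) \esum_(j in J i) a i j = \esum_(j in B) \esum_(i in K j) a i j.
Proof.
move=> a0 AB; rewrite !esum_esum//.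
rewrite (reindex_esum (B `*`` K) (A `*`` J) (fun x => (x.2, x.1)))//; split.
- by move=> [j i] /= ?; apply/AB.
- by move=> [j i] [j' i'] _ _ /= [-> ->].
- by move=> [i j] /= /AB ?; exists (j, i).
Qed.

Lemma esum_le_card (T : choiceType) (U : finType) (A : set T) (e : U -> T)
    (c : \bar R) : 0 <= c -> A `<=` range e ->
  \esum_(i in A) c <= #|U|%:R%:E * c.
Proof.
move=> c0 Ae; apply: ge_ereal_sup => _ [X [finX XA] <-].
have iterE k : iter k (+%R c) 0%R = k%:R%:E * c.
  elim: k => [|k IH]; first by rewrite mul0e.
  by rewrite iterS IH -natr1 EFinD ge0_muleDl ?lee_fin// mul1e addeC.
rewrite fsbig_finite//= big_const_seq count_predT iterE.
apply: lee_wpmul2r => //; rewrite lee_fin ler_nat.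
have -> : #|U| = size [seq e u | u <- enum U] by rewrite size_map cardT.
apply: uniq_leq_size => [|x]; first exact: finmap.fset_uniq.
rewrite in_fset_set// inE => /XA/Ae[u _ <-].
by apply: map_f; rewrite mem_enum.
Qed.

End esum_complements.

(** * Dyadic cubes as index vectors *)

Section grid_indices.
Variable n : nat.
Local Notation I := {ffun 'I_n -> int}.

(* A cube of generation [k] is the index vector of its corner, in units of the
   side of generation [k]; [ancestor m] is the cube containing it [m] generations up. *)
Definition ancestor (m : nat) (p : I) : I := [ffun t => (p t %/ (2 ^ m)%:Z)%Z].

Definition near_index (r : nat) (p : I) : set I :=
  [set p' | forall t, (`|p t - p' t| <= r%:Z)%R].

Lemma ancestor0 p : ancestor 0 p = p.
Proof. by apply/ffunP => t; rewrite ffunE expn0 divz1. Qed.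

Lemma ancestorD m l p : ancestor (m + l) p = ancestor m (ancestor l p).
Proof.
by apply/ffunP => t; rewrite !ffunE expnD mulnC PoszM divzMA_ge0.
Qed.

Lemma near_index_sym r p p' : near_index r p p' -> near_index r p' p.
Proof. by move=> pp' t; rewrite distrC. Qed.

Lemma near_index_trans r s p1 p2 p3 :
  near_index r p1 p2 -> near_index s p2 p3 -> near_index (r + s) p1 p3.
Proof. by move=> h1 h2 t; have := h1 t; have := h2 t; lia. Qed.

(** Write [a = x * d + u] and [b = y * d + v] with remainders below [d]. If [x - y] were at least
    [r + 1], then [a - b] would be at least [(r + 1) * d - (d - 1)], which exceeds [r]. *)
Lemma near_index_ancestor r m p p' :
  near_index r p p' -> near_index r (ancestor m p) (ancestor m p').
Proof.
move=> h t; have := h t; rewrite !ffunE.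
have : (0 < (2 ^ m)%:Z)%R by rewrite ltz_nat expn_gt0.
move: (2 ^ m)%:Z (p t) (p' t) => d a b d0.
have d_neq0 : d != 0 by rewrite gt_eqF.
have [a0 b0] := (modz_ge0 a d_neq0, modz_ge0 b d_neq0).
have [a1 b1] := (ltz_pmod a d0, ltz_pmod b d0).
rewrite {1}(divz_eq a d) {1}(divz_eq b d).
move: (a %/ d)%Z (b %/ d)%Z (a %% d)%Z (b %% d)%Z a0 b0 a1 b1 => x y u v *.
have [xy|xy] : (x - y <= r%:Z /\ y - x <= r%:Z) \/
    (r%:Z + 1 <= x - y \/ r%:Z + 1 <= y - x) by lia.
  by lia.
by nia.
Qed.

(** Halving brings a distance of 2 down to 1: one step to the parents absorbs one enlargement by
    neighbours. This is what closes the induction over the scales. *)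
Lemma near_index_parent p p' :
  near_index 2 p p' -> near_index 1 (ancestor 1 p) (ancestor 1 p').
Proof. by move=> h t; have := h t; rewrite !ffunE; lia. Qed.

End grid_indices.

(** * Sums over neighbouring cubes *)

Section near_sums.
Local Open Scope ereal_scope.
Context {R : realType} (n : nat).
Local Notation I := {ffun 'I_n -> int}.
Implicit Types (f : I -> \bar R) (p : I) (r : nat).

(** When [f] gives the measures of the cubes of one generation, this is the measure of the
    concentric dilate of the cube [p] by the factor [2 * r + 1]. *)
Definition near_sum r f p := \esum_(p' in near_index r p) f p'.

Lemma near_sum_ge0 r f p : (forall p, 0 <= f p) -> 0 <= near_sum r f p.
Proof. by move=> f0; exact: esum_ge0. Qed.

Lemma le_near_sum r s f p p' :
  near_index r p p' -> near_sum s f p <= near_sum (s + r) f p'.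
Proof.
move=> pp'; apply: subset_le_esum => x px.
by rewrite addnC; apply: near_index_trans px; exact: near_index_sym.
Qed.

Lemma near_sum_ge r f p : (forall p, 0 <= f p) -> f p <= near_sum r f p.
Proof.
move=> f0; rewrite -[leLHS](@esum_set1 R _ p f)//.
by apply: subset_le_esum => _ -> t; rewrite subrr normr0.
Qed.

Lemma esum_near_const r p (c : \bar R) (S : set I) : 0 <= c ->
  S `<=` near_index r p -> \esum_(p' in S) c <= ((2 * r + 1) ^ n)%:R%:E * c.
Proof.
move=> c0 Sp; have -> : ((2 * r + 1) ^ n = #|{ffun 'I_n -> 'I_(2 * r).+1}|)%N.
  by rewrite card_ffun !card_ord addn1.
(* Neighbours are parametrised by their offsets from the corner [p - r]; each coordinate takes
   [2 * r + 1] values. *)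
apply: (@esum_le_card _ _ _ _ (fun e : {ffun 'I_n -> 'I_(2 * r).+1} =>
  [ffun t => p t + (e t)%:Z - r%:Z]%R)) => // p' /Sp pp'.
exists [ffun t => inord (absz (p' t - p t + r%:Z)%R)] => //.
have offsetP (x y : int) : (`|x - y| <= r%:Z)%R ->
    (absz (y - x + r%:Z)%R < (2 * r).+1)%N /\
    (x + (absz (y - x + r%:Z)%R)%:Z - r%:Z = y)%R by lia.
by apply/ffunP => t; have [? ?] := offsetP _ _ (pp' t); rewrite !ffunE inordK.
Qed.

(* Interchanging the two sums, each index is counted at most (2 r + 1)^n times. *)
Lemma esum_mul_near_sum_le r (S S' : set I) (a a' : I -> R) f :
  (forall p, 0 <= a p)%R -> (forall p, 0 <= a' p)%R -> (forall p, 0 <= f p) ->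
  (forall p p', S p -> near_index r p p' -> S' p' /\ (a p <= a' p')%R) ->
  \esum_(p in S) ((a p)%:E * near_sum r f p) <=
    ((2 * r + 1) ^ n)%:R%:E * \esum_(p in S') ((a' p)%:E * f p).
Proof.
move=> a0 a'0 f0 SS'.
have af0 p p' : 0 <= (a p)%:E * f p' by rewrite mule_ge0// lee_fin.
apply: (@le_trans _ _
    (\esum_(p in S) \esum_(p' in near_index r p) ((a p)%:E * f p'))).
  by apply: le_esum => p _; exact: esumZl_ge.
rewrite (esum_exchange (B := S') (K := fun p' => S `&` near_index r p'))//; last first.
  move=> p p'; split=> [[Sp pp']|[_ [Sp /near_index_sym]]//].
  by have [] := SS' _ _ Sp pp'; split => //; split => //; exact: near_index_sym.
apply: (@le_trans _ _
    (\esum_(p in S') (((2 * r + 1) ^ n)%:R%:E * ((a' p)%:E * f p)))); last first.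
  by apply: esumZl_le => // p; rewrite mule_ge0// lee_fin.
apply: le_esum => p' _.
apply: (@le_trans _ _ (\esum_(p in S `&` near_index r p') ((a' p')%:E * f p'))).
  apply: le_esum => p [Sp /near_index_sym pp']; apply: lee_wpmul2r => //.
  by rewrite lee_fin; have [] := SS' _ _ Sp pp'.
apply: (@esum_near_const r p') => //.
by apply: mule_ge0; rewrite ?lee_fin.
Qed.

Lemma esum_near_sum_le r (S S' : set I) f : (forall p, 0 <= f p) ->
  (forall p p', S p -> near_index r p p' -> S' p') ->
  \esum_(p in S) near_sum r f p <= ((2 * r + 1) ^ n)%:R%:E * \esum_(p in S') f p.
Proof.
move=> f0 SS'.
have mul1S (T : set I) (g : I -> \bar R) :
    \esum_(p in T) g p = \esum_(p in T) (1%:E * g p).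
  by apply: eq_esum => p _; rewrite mul1e.
rewrite mul1S [X in _ <= _ * X]mul1S.
apply: (@esum_mul_near_sum_le r S S' (cst 1%R) (cst 1%R)) => // p p' Sp pp'.
by split => //; exact: SS' pp'.
Qed.

End near_sums.

(** * The estimate on a dyadic grid *)

Section dyadic_estimate.
Local Open Scope ereal_scope.
Context {R : realType} (n : nat).
Local Notation I := {ffun 'I_n -> int}.

Lemma esum_ancestor (u : nat -> I -> \bar R) (S : set I) k m :
  (forall k p, 0 <= u k p) ->
  (forall k i, u k i = \esum_(p in ancestor 1 @^-1` [set i]) u k.+1 p) ->
  \esum_(p in S) u k p = \esum_(p in ancestor m @^-1` S) u (k + m)%N p.
Proof.
move=> u0 uS; elim: m => [|m IH].
  rewrite addn0; congr (esum _ _).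
  by apply/seteqP; split => p; rewrite /preimage/= ancestor0.
rewrite IH (eq_esum (b := fun p => \esum_(p' in ancestor 1 @^-1` [set p]) u (k + m).+1 p'));
  last by move=> p _; rewrite uS.
rewrite -esum_preimage// addnS; congr (esum _ _).
by apply/seteqP; split => p; rewrite /preimage/= -ancestorD addn1.
Qed.

(* [w k p] is the weight and [v k p] the normalised mass of the cube [p] of
   generation [k]. With [kappa = 2^(n - alpha)] and [beta = 2^(alpha / 2)],
   [density 1] and [density 2] are the quotients mu(Q') / l(Q)^(n - alpha) over two
   dilates Q' of the cube Q. *)
Variables (w v : nat -> I -> \bar R) (q theta Cs A kappa beta : R).
Hypotheses (w_ge0 : forall k p, 0 <= w k p) (v_ge0 : forall k p, 0 <= v k p).
Hypothesis wS : forall k i, w k i = \esum_(p in ancestor 1 @^-1` [set i]) w k.+1 p.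
Hypothesis vS : forall k i, v k i = \esum_(p in ancestor 1 @^-1` [set i]) v k.+1 p.
Hypothesis v_growth : forall k p, near_sum 2 (v k) p <= (A * kappa ^- k)%:E.
Hypothesis w_Ainfty : forall k m i (S : set I) (c : R),
  S `<=` ancestor m @^-1` [set i] -> (0 <= c)%R -> \esum_(p in S) 1 <= c%:E ->
  \esum_(p in S) w (k + m)%N p <=
    (Cs * (c / 2 ^+ (m * n)) `^ theta)%:E * near_sum 1 (w k) i.
Hypotheses (q_gt0 : (0 < q)%R) (Cs_gt0 : (0 < Cs)%R).
Hypotheses (A_gt0 : (0 < A)%R) (kappa_gt0 : (0 < kappa)%R) (beta_gt1 : (1 < beta)%R).
Hypothesis kappa_beta : (kappa * beta ^+ 2 = 2 ^+ n)%R.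

Definition density r k p : R := (fine (near_sum r (v k) p) * kappa ^+ k)%R.

Lemma near_sum2_fin_num k p : near_sum 2 (v k) p \is a fin_num.
Proof.
by rewrite ge0_fin_numE ?near_sum_ge0// (le_lt_trans (v_growth k p))// ltry.
Qed.

Lemma density_ge0 r k p : (0 <= density r k p)%R.
Proof. by rewrite mulr_ge0 ?fine_ge0 ?near_sum_ge0// exprn_ge0// ltW. Qed.

Lemma density2K k p : (density 2 k p * kappa ^- k)%:E = near_sum 2 (v k) p.
Proof.
rewrite /density -mulrA mulfV ?mulr1 ?fineK ?near_sum2_fin_num//.
by rewrite expf_neq0 ?gt_eqF.
Qed.

Lemma density2_le k p : (density 2 k p <= A)%R.
Proof.
have := v_growth k p; rewrite -density2K lee_fin ler_pM2r//.
by rewrite invr_gt0 exprn_gt0.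
Qed.

Lemma density1_le k p p' : near_index 1 p p' -> (density 1 k p <= density 2 k p')%R.
Proof.
move=> pp'; rewrite /density ler_wpM2r ?exprn_ge0 ?(ltW kappa_gt0)//.
have le12 := @le_near_sum R n 1 1 (v k) _ _ pp'.
rewrite fine_le ?near_sum2_fin_num//.
rewrite ge0_fin_numE ?near_sum_ge0// (le_lt_trans le12)//.
by rewrite -ge0_fin_numE ?near_sum_ge0// near_sum2_fin_num.
Qed.

(** The two summands account for the cubes of density at most [beta ^- m] and for the exceptional
    ones, [m] generations down; both are geometric in [m]. *)
Definition decay m : R :=
  ((beta^-1 `^ q) ^+ m +
   A `^ q * Cs * (5 ^+ n * A) `^ theta * (beta^-1 `^ theta) ^+ m)%R.

Let beta_gt0 : (0 < beta)%R. Proof. exact: lt_trans beta_gt1. Qed.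

Let powR_expr (x : R) m p : (0 <= x)%R -> ((x ^+ m) `^ p = (x `^ p) ^+ m)%R.
Proof. by move=> x0; rewrite -(powR_mulrn m x0) powRAC (powR_mulrn m (powR_ge0 x p)). Qed.

(** Chebyshev's inequality: each counted cube has a dilate of mass above
    [beta ^- m * kappa ^- (k + m)]. These dilates overlap at most [5 ^+ n] times and lie in the
    dilate of [i], whose mass is at most [A * kappa ^- k]. *)
Lemma card_dense_le k m i :
  \esum_(p in [set p | ancestor m p = i /\ (beta ^- m < density 2 (k + m) p)%R]) 1
    <= (5 ^+ n * A * kappa ^+ m * beta ^+ m)%:E.
Proof.
set S := [set p | _].
have c_gt0 : (0 < beta ^- m * kappa ^- (k + m))%R.
  by rewrite mulr_gt0 ?invr_gt0 ?exprn_gt0.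
suff h : (beta ^- m * kappa ^- (k + m))%:E * (\esum_(p in S) 1) <=
    (5 ^+ n)%:E * (A * kappa ^- k)%:E.
  rewrite -(@lee_pmul2l _ (beta ^- m * kappa ^- (k + m))%:E)//; apply: le_trans h _.
  rewrite -!EFinM lee_fin exprD invfM le_eqVlt; apply/orP; left; apply/eqP.
  by field; rewrite !expf_neq0 ?gt_eqF.
apply: (@le_trans _ _ (\esum_(p in S) near_sum 2 (v (k + m)%N) p)).
  apply: le_trans (esumZl_ge _ _ _) _; [exact: ltW|by []|].
  apply: le_esum => p [_ pS]; rewrite mule1 -density2K lee_fin.
  by rewrite ler_wpM2r ?ltW// invr_gt0 exprn_gt0.
apply: le_trans (esum_near_sum_le (S' := ancestor m @^-1` near_index 2 i) _ _) _ => //.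
  by move=> p p' [<- _]; exact: near_index_ancestor.
rewrite -(esum_ancestor _ _ _ v_ge0 vS) natrX.
by apply: lee_wpmul2l => //; exact: v_growth.
Qed.

(* The density is at most [beta ^- m] outside few cubes; on the few exceptional
   ones it is at most [A], and they carry little weight by the A_infty bound. *)
Lemma esum_density_le k m i :
  \esum_(p in ancestor m @^-1` [set i]) ((density 2 (k + m) p `^ q)%:E * w (k + m)%N p)
    <= (decay m)%:E * near_sum 1 (w k) i.
Proof.
have c0 r p : 0 <= (density 2 r p `^ q)%:E by rewrite lee_fin powR_ge0.
have wi_le : w k i <= near_sum 1 (w k) i by exact: near_sum_ge.
rewrite (esumID [set p | (density 2 (k + m) p <= beta ^- m)%R]); last first.
  by move=> p _; rewrite mule_ge0.
have -> : (decay m)%:E * near_sum 1 (w k) i =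
   ((beta ^- m) `^ q)%:E * near_sum 1 (w k) i +
   (A `^ q)%:E * ((Cs * (5 ^+ n * A * kappa ^+ m * beta ^+ m / 2 ^+ (m * n)) `^ theta)%:E
      * near_sum 1 (w k) i).
  rewrite muleA -ge0_muleDl ?near_sum_ge0//; last 2 first.
    by rewrite lee_fin powR_ge0.
    by rewrite -EFinM lee_fin !mulr_ge0 ?powR_ge0// ltW.
  rewrite -EFinM -EFinD; congr (_%:E * _); rewrite /decay; congr (_ + _)%R.
    by rewrite -exprVn powR_expr// invr_ge0 ltW.
  rewrite -mulrA -mulrA; congr (_ * (_ * _))%R.
  rewrite -powR_expr ?invr_ge0 ?(ltW beta_gt0)// -powRM; last 2 first.
    by rewrite mulr_ge0 ?exprn_ge0// ltW.
    by rewrite exprn_ge0// invr_ge0 ltW.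
  (* Since [2 ^+ n = kappa * beta ^+ 2], the exceptional cubes fill a proportion of at most
     [5 ^+ n * A * beta ^- m]. *)
  congr (_ `^ _)%R; rewrite mulnC exprM -kappa_beta exprMn -exprM mul2n -addnn exprD exprVn.
  by field; rewrite !expf_neq0 ?gt_eqF.
apply: leeD.
  apply: (@le_trans _ _ (\esum_(p in ancestor m @^-1` [set i])
      (((beta ^- m) `^ q)%:E * w (k + m)%N p))); last first.
    apply: le_trans (esumZl_le _ _ _) _ => //; first exact: powR_ge0.
    rewrite -esum_ancestor// esum_set1//.
    by apply: lee_wpmul2l => //; rewrite lee_fin powR_ge0.
  apply: le_trans (subset_le_esum _ (@subIsetl _ _ _)) => //.
  apply: le_esum => p [_ /= pb]; apply: lee_wpmul2r => //.
  by rewrite lee_fin ge0_ler_powR ?(ltW q_gt0)// nnegrE ?density_ge0// invr_ge0 exprn_ge0// ltW.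
rewrite [X in esum X _](_ : _ = [set p | ancestor m p = i /\
    (beta ^- m < density 2 (k + m) p)%R]); last first.
  apply/seteqP; split => p [pi] /=; first by move/negP; rewrite -ltNge.
  by rewrite ltNge => /negP.
apply: (@le_trans _ _ ((A `^ q)%:E * (\esum_(p in [set p | ancestor m p = i /\
    (beta ^- m < density 2 (k + m) p)%R]) w (k + m)%N p))).
  apply: le_trans (esumZl_le _ _ _) => //; last exact: powR_ge0.
  apply: le_esum => p _; apply: lee_wpmul2r => //.
  by rewrite lee_fin ge0_ler_powR ?(ltW q_gt0) ?nnegrE ?density_ge0 ?density2_le// ltW.
apply: lee_wpmul2l; first by rewrite lee_fin powR_ge0.
apply: w_Ainfty; [by move=> p []| |exact: card_dense_le].
by rewrite !mulr_ge0 ?exprn_ge0// ltW.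
Qed.

(* [F k i] stands for the integral over the cube [i] of generation [k] of the
   product over k < j <= J of (1 + c density_j^q), against the weight. *)
Section product_estimate.
Variables (c : R) (F : nat -> I -> \bar R) (J : nat).
Hypotheses (c_ge0 : (0 <= c)%R) (F_ge0 : forall k i, 0 <= F k i).
Hypothesis F_last : forall i, F J i = w J i.
Hypothesis F_rec : forall k i, (k < J)%N ->
  F k i = \esum_(p in ancestor 1 @^-1` [set i])
            ((1 + c * density 1 k.+1 p `^ q)%:E * F k.+1 p).

Let cd_ge0 d r k p : (0 <= d)%R -> (0 <= d * density r k p `^ q)%R.
Proof. by move=> d0; rewrite mulr_ge0 ?powR_ge0. Qed.

(* Expand the product according to the coarsest factor that is not [1]. *)
Lemma product_expansion m k i : (k + m)%N = J ->
  F k i = w k i + \sum_(l < m) \esum_(p in ancestor l.+1 @^-1` [set i])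
     ((c * density 1 (k + l.+1) p `^ q)%:E * F (k + l.+1)%N p).
Proof.
elim: m k i => [|m IH] k i; first by rewrite addn0 => ->; rewrite big_ord0 adde0.
move=> kmJ; rewrite F_rec; last by rewrite -kmJ -addSnnS ltnS leq_addr.
have cdF_ge0 k' p : 0 <= (c * density 1 k' p `^ q)%:E * F k' p.
  by rewrite mule_ge0// lee_fin cd_ge0.
(* The factor of generation [k.+1] contributes either [1], and the induction hypothesis expands
   [F k.+1], or its second summand, which is the term [l = 0]. *)
rewrite (eq_esum (b := fun p => F k.+1 p + (c * density 1 k.+1 p `^ q)%:E * F k.+1 p));
  last by move=> p _; rewrite EFinD ge0_muleDl ?lee_fin ?cd_ge0// mul1e.
rewrite esumD// big_ord_recl/= addn1 [X in _ = w k i + X]addeC addeA; congr (_ + _).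
rewrite (eq_esum (b := fun p => w k.+1 p +
  \sum_(l < m) \esum_(p' in ancestor l.+1 @^-1` [set p])
     ((c * density 1 (k.+1 + l.+1) p' `^ q)%:E * F (k.+1 + l.+1)%N p'))); last first.
  by move=> p _; apply: IH; rewrite addSnnS.
rewrite esumD//; last by move=> p _; apply: sume_ge0 => l _; apply: esum_ge0.
rewrite -wS esum_sum; last by move=> p l _ _; exact: esum_ge0.
congr (w k i + _); apply: eq_bigr => l _.
rewrite -esum_preimage; last by move=> p; exact: cdF_ge0.
rewrite /bump/= add1n addSnnS; congr (esum _ _).
by apply/seteqP; split => p; rewrite /preimage/= -ancestorD add1n.
Qed.

(* Moving from a cube to its neighbours turns [density 1] into [density 2]; this
   enlargement occurs at a strictly finer generation than [k], so that the total
   dilation of the cube [i] stays below that of [near_sum 1]. *)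
Lemma expansion_term_le l k i :
  (forall p, F (k + l.+1) p <= 2%:E * near_sum 1 (w (k + l.+1)) p) ->
  \esum_(p in ancestor l.+1 @^-1` [set i])
     ((c * density 1 (k + l.+1) p `^ q)%:E * F (k + l.+1)%N p) <=
  (2 * c * 9 ^+ n * decay l)%:E * near_sum 1 (w k) i.
Proof.
move=> FN.
pose a r p := (2 * c * density r (k + l.+1) p `^ q)%R.
have a_ge0 r p : (0 <= a r p)%R by rewrite cd_ge0// mulr_ge0.
(* The children of [i] and the cubes adjacent to one of them: every neighbour of a descendant of [i]
   descends from a member of [Z]. *)
pose Z := [set r : I | exists2 r0, near_index 1 r0 r & ancestor 1 r0 = i].
apply: (@le_trans _ _ (\esum_(p in ancestor l.+1 @^-1` [set i])
    ((a 1%N p)%:E * near_sum 1 (w (k + l.+1)%N) p))).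
  apply: le_esum => p _; apply: le_trans (lee_wpmul2l _ (FN p)) _.
    by rewrite lee_fin cd_ge0.
  by rewrite muleA -EFinM /a mulrC mulrA.
have step := @esum_mul_near_sum_le R n 1 (ancestor l.+1 @^-1` [set i])
  (ancestor l @^-1` Z) (a 1%N) (a 2%N) (w (k + l.+1)%N)
  (a_ge0 1%N) (a_ge0 2%N) (w_ge0 _).
apply: le_trans (step _) _.
  move=> p p' pi pp'; split.
    exists (ancestor l p); first exact: near_index_ancestor.
    by rewrite -ancestorD add1n.
  apply: ler_wpM2l; first exact: mulr_ge0.
  apply: ge0_ler_powR; rewrite ?nnegrE; [exact: ltW|exact: density_ge0..|].
  exact: density1_le.
(* The constant [9 ^+ n] is spent in two halves: one [3 ^+ n] for the move to neighbours at
   generation [k + l.+1], one for summing [near_sum 1] over [Z]. *)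
pose T : R := ((2 * 1 + 1) ^ n)%:R%R.
have -> : (2 * c * 9 ^+ n * decay l)%R = (T * (2 * c * decay l * T))%R.
  have -> : (9 ^+ n = T * T :> R)%R by rewrite /T -natrM -expnMn natrX.
  by rewrite [RHS]mulrC -[RHS]mulrA mulrAC.
rewrite [in leRHS](EFinM T) -muleA.
apply: lee_wpmul2l => //.
have decay_ge0 : (0 <= decay l)%R.
  by rewrite addr_ge0// ?mulr_ge0 ?exprn_ge0 ?powR_ge0// ltW.
apply: (@le_trans _ _ (\esum_(r in Z) ((2 * c * decay l)%:E * near_sum 1 (w k.+1) r))).
  rewrite esum_preimage; last by move=> p; rewrite mule_ge0// lee_fin.
  apply: le_esum => r _.
  rewrite (eq_esum (b := fun p => (2 * c)%:E *
     ((density 2 (k.+1 + l) p `^ q)%:E * w (k.+1 + l)%N p))); last first.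
    by move=> p _; rewrite muleA -EFinM addSnnS.
  apply: le_trans (esumZl_le _ _ _) _; first by rewrite mulr_ge0.
    by move=> p; rewrite mule_ge0// lee_fin powR_ge0.
  rewrite [in leRHS](EFinM (2 * c)) -muleA; apply: lee_wpmul2l.
    by rewrite lee_fin mulr_ge0.
  exact: esum_density_le.
apply: le_trans (esumZl_le _ _ _) _; first by rewrite !mulr_ge0.
  by move=> p; exact: near_sum_ge0.
rewrite [in leRHS](EFinM (2 * c * decay l)) -muleA; apply: lee_wpmul2l.
  by rewrite lee_fin !mulr_ge0.
(* A neighbour of a member of [Z] is within 2 of a child of [i], so its parent is within 1 of
   [i]. *)
apply: le_trans (esum_near_sum_le (S' := ancestor 1 @^-1` near_index 1 i) _ _) _ => //.
  move=> r r' [r0 r0r <-] rr'; apply: near_index_parent.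
  exact: near_index_trans r0r rr'.
rewrite -[k.+1]addn1 -(esum_ancestor _ _ _ w_ge0 wS).
exact: lexx.
Qed.

(** Strong induction on the number [J - k] of remaining scales. The term [w k i] costs one
    [near_sum 1 (w k) i], and the smallness of [c] makes all the expansion terms together cost at
    most one more; the bound is thus independent of [J]. *)
Lemma product_le K k i : (k <= J)%N ->
  (forall m, (\sum_(l < m) decay l <= K)%R) -> (2 * c * 9 ^+ n * K <= 1)%R ->
  F k i <= 2%:E * near_sum 1 (w k) i.
Proof.
move=> + decayK cK; move mE : (J - k)%N => m.
elim/ltn_ind: m k i mE => m IH k i mE kJ.
have kmJ : (k + m)%N = J by rewrite -mE subnKC.
rewrite (product_expansion i kmJ).
apply: (@le_trans _ _ (near_sum 1 (w k) i +
   \sum_(l < m) (2 * c * 9 ^+ n * decay l)%:E * near_sum 1 (w k) i)).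
  apply: leeD; first exact: near_sum_ge.
  apply: lee_sum => l _; apply: expansion_term_le => p.
  apply: (IH (m - l.+1)%N); last by rewrite -kmJ leq_add2l.
    by rewrite ltn_subrL/= (leq_ltn_trans _ (ltn_ord l)).
  by rewrite subnDA mE.
rewrite -ge0_sume_distrl; last first.
  move=> l _; rewrite lee_fin !mulr_ge0 ?exprn_ge0//.
  by rewrite addr_ge0// ?mulr_ge0 ?exprn_ge0 ?powR_ge0// ltW.
rewrite sumEFin -mulr_sumr (_ : 2%:E = 1 + 1 :> \bar R)//.
rewrite ge0_muleDl// mul1e; apply: leeD => //.
rewrite -[leRHS]mul1e; apply: lee_wpmul2r; first exact: near_sum_ge0.
rewrite lee_fin (le_trans _ cK)// ler_wpM2l//.
by rewrite !mulr_ge0 ?exprn_ge0.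
Qed.

End product_estimate.

End dyadic_estimate.

(** * Summability of the decay *)

Lemma powRV_lt1 {R : realType} (x p : R) : 1 < x -> 0 < p -> x^-1 `^ p < 1.
Proof.
move=> x1 p0; rewrite [ltRHS](_ : 1 = 1 `^ p); last by rewrite powR1.
have x0 : 0 < x by exact: lt_trans x1.
by rewrite gt0_ltr_powR// ?nnegrE ?invr_ge0 ?(ltW x0)// invf_lt1.
Qed.

Lemma sum_decay_le {R : realType} n (q theta Cs A beta : R) m :
  0 < q -> 0 < theta -> 0 <= Cs -> 1 < beta ->
  \sum_(l < m) decay n q theta Cs A beta l <=
   (1 - beta^-1 `^ q)^-1 +
   A `^ q * Cs * (5 ^+ n * A) `^ theta * (1 - beta^-1 `^ theta)^-1.
Proof.
move=> q0 theta0 Cs0 beta1.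
have geom (p : R) : 0 < p -> \sum_(l < m) (beta^-1 `^ p) ^+ l <= (1 - beta^-1 `^ p)^-1.
  move=> p0; set x := beta^-1 `^ p.
  have x0 : 0 <= x by exact: powR_ge0.
  have x1 : x < 1 by exact: powRV_lt1.
  rewrite -(ler_pM2l (x := 1 - x)) ?subr_gt0// mulfV ?gt_eqF ?subr_gt0//.
  by rewrite -(opprB x 1) mulNr -subrX1 opprB lerBlDr lerDl exprn_ge0.
rewrite /decay big_split/=; apply: lerD; first exact: geom.
rewrite -mulr_sumr ler_wpM2l ?geom// !mulr_ge0 ?powR_ge0//.
Qed.

(** * Measures and integrals over the fibers of a map to a countable type *)

Section countable_fibers.
Local Open Scope ereal_scope.
Context d (T : measurableType d) (R : realType) (I : countType) (f : T -> I).
Hypothesis mf : forall i, measurable (f @^-1` [set i]).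

(** The fibers over [S] arranged as a sequence by means of [pickle], with the empty set at every
    number that is not the code of an element of [S] in the range of [f]. *)
Let F (S : set I) m : set T := [set x | S (f x) /\ pickle (f x) = m].

Let measurable_F S m : measurable (F S m).
Proof.
have [[i Si im]|noti] := pselect (exists2 i, S i & pickle i = m).
  rewrite (_ : F S m = f @^-1` [set i])//; apply/seteqP; split => x /=.
    by move=> [_]; rewrite -im => /(pcan_inj pickleK).
  by rewrite /F/= => ->.
rewrite (_ : F S m = set0)//; apply/seteqP; split => x //= [Sx xm].
by apply: noti; exists (f x).
Qed.

Let bigcup_F S : \bigcup_m F S m = f @^-1` S.
Proof.
by apply/seteqP; split => x /=; [case=> m _ [] | exists (pickle (f x))].
Qed.

Let trivIset_F S : trivIset setT (F S).
Proof. by move=> m m' _ _ [x [[_ <-] [_ <-]]]. Qed.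

Lemma measurable_preimage_countType (S : set I) : measurable (f @^-1` S).
Proof. by rewrite -bigcup_F; exact: bigcup_measurable. Qed.

Let esum_F (S : set I) (a : set T -> \bar R) : a set0 = 0 -> (forall A, 0 <= a A) ->
  \sum_(m <oo) a (F S m) = \esum_(i in S) a (f @^-1` [set i]).
Proof.
move=> a_set0 a0; rewrite nneseries_esumT//.
rewrite -(@eq_esum R I S (fun i => a (F S (pickle i)))); last first.
  move=> i Si; congr a; apply/seteqP; split => x /=; rewrite /F/=.
    by move=> [_ /(pcan_inj pickleK)].
  by move=> ->.
rewrite -(@esum_image R I nat S pickle (fun m => a (F S m))); last first.
  by move=> i j _ _ /(pcan_inj pickleK).
rewrite [RHS]esum_mkcond; apply: eq_esum => m _; case: ifPn => //.
rewrite notin_setE => Sm; rewrite (_ : F S m = set0)//.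
by apply/seteqP; split => x //= [Sx xm]; apply: Sm; exists (f x).
Qed.

Lemma measure_preimage_esum (m : {measure set T -> \bar R}) (S : set I) :
  m (f @^-1` S) = \esum_(i in S) m (f @^-1` [set i]).
Proof.
rewrite -esum_F// -bigcup_F measure_semi_bigcup//.
by rewrite bigcup_F; exact: measurable_preimage_countType.
Qed.

Lemma ge0_integral_preimage_esum (m : {measure set T -> \bar R}) (S : set I)
    (g : T -> \bar R) :
  measurable_fun setT g -> (forall x, 0 <= g x) ->
  \int[m]_(x in f @^-1` S) g x = \esum_(i in S) \int[m]_(x in f @^-1` [set i]) g x.
Proof.
move=> mg g0.
rewrite -(@esum_F S (fun A => \int[m]_(x in A) g x)); last 2 first.
- exact: integral_set0.
- by move=> A; exact: integral_ge0.
rewrite -bigcup_F ge0_integral_bigcup//.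
exact: measurable_funTS.
Qed.

Lemma measurable_fun_comp_countType d' (U : measurableType d') (h : I -> U) :
  measurable_fun setT (h \o f).
Proof.
move=> _ Y mY; rewrite setTI comp_preimage; exact: measurable_preimage_countType.
Qed.

End countable_fibers.

(** * Geometry of the grid *)

Section euclidean_norm.
Context {R : realType} (n : nat).
Implicit Types a d : 'I_n -> R.

Definition enorm a : R := Num.sqrt (\sum_(i < n) a i ^+ 2).

Lemma enorm_ge0 a : 0 <= enorm a. Proof. exact: sqrtr_ge0. Qed.

Lemma sqr_enorm a : enorm a ^+ 2 = \sum_(i < n) a i ^+ 2.
Proof. by rewrite sqr_sqrtr// sumr_ge0// => i _; exact: sqr_ge0. Qed.

Lemma coord_le_enorm a i : `|a i| <= enorm a.
Proof.
rewrite -sqrtr_sqr ler_wsqrtr// (bigD1 i)//= lerDl sumr_ge0// => j _.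
exact: sqr_ge0.
Qed.

(* A Cauchy-Schwarz-free triangle inequality, with the l^1 norm of the increment. *)
Lemma enormD_le a d : enorm (fun i => a i + d i) <= enorm a + \sum_(i < n) `|d i|.
Proof.
have D0 : 0 <= \sum_(i < n) `|d i| by apply: sumr_ge0.
rewrite -(ler_pXn2r (n := 2))// ?nnegrE ?addr_ge0 ?enorm_ge0//.
rewrite sqr_enorm sqrrD sqr_enorm -addrA.
under eq_bigr do rewrite sqrrD.
(* Cross terms are bounded through [coord_le_enorm]; the sum of the squares of the [d i] is at most
   the square of the sum of their absolute values. *)
rewrite !big_split/= -addrA lerD2l; apply: lerD.
  rewrite mulr_sumr mulr2n; apply: lerD; apply: ler_sum => i _;
  apply: le_trans (ler_norm _) _; rewrite normrM;
  by rewrite ler_wpM2r// coord_le_enorm.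
rewrite [leRHS]expr2 mulr_suml; apply: ler_sum => i _.
rewrite -real_normK ?num_real// expr2 ler_wpM2l//.
by rewrite (bigD1 i)//= lerDl sumr_ge0.
Qed.

Lemma enorm_le_sum a : enorm a <= \sum_(i < n) `|a i|.
Proof.
have := enormD_le (fun=> 0) a; rewrite /enorm.
rewrite [X in Num.sqrt X + _]big1 => [|i _]; last by rewrite expr0n.
rewrite sqrtr0 add0r; under eq_bigr do rewrite add0r; exact.
Qed.

End euclidean_norm.

Section grid.
Context {R : realType} (n : nat) (s : R).
Hypothesis s_gt0 : 0 < s.
Local Notation I := {ffun 'I_n -> int}.
Implicit Types (x y : Rn R n) (k : nat) (p : I).

Definition side k : R := s / 2 ^+ k.

Definition grid_index k x : I := [ffun t => Num.floor (tnth x t / side k)].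

Lemma side_gt0 k : 0 < side k.
Proof. by rewrite divr_gt0// exprn_gt0. Qed.

Lemma sideD k m : side (k + m) = side k / 2 ^+ m.
Proof. by rewrite /side exprD invfM mulrA. Qed.

Lemma grid_indexP k x t :
  (grid_index k x t)%:~R * side k <= tnth x t < ((grid_index k x t)%:~R + 1) * side k.
Proof.
rewrite ffunE -ler_pdivlMr ?side_gt0// -ltr_pdivrMr ?side_gt0//.
by rewrite -intrD1 floor_itv.
Qed.

(** Half-open cells are nested: if [z] is the quotient of the integer [f] by [2 ^ m], then
    [z * 2 ^ m <= f] and [f + 1 <= (z + 1) * 2 ^ m]. *)
Lemma ancestor_grid_index k m x : ancestor m (grid_index (k + m) x) = grid_index k x.
Proof.
apply/ffunP => t; rewrite [LHS]ffunE [RHS]ffunE; apply/esym/floor_def.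
have /andP[] := grid_indexP (k + m) x t.
rewrite ffunE sideD; set f := Num.floor _; rewrite ler_pdivlMr ?side_gt0// ltr_pdivrMr ?side_gt0//.
have d_gt0 : (0 < (2 ^ m)%:Z)%R by rewrite ltz_nat expn_gt0.
have := divz_eq f (2 ^ m)%:Z; have := modz_ge0 f (lt0r_neq0 d_gt0).
have := ltz_pmod f d_gt0; move: (f %/ _)%Z (f %% _)%Z => z u u1 u0 fE xl xr.
have dR : (2 ^ m)%:Z%:~R = 2 ^+ m :> R by rewrite -pmulrn natrX.
have S0 : 0 < side k / 2 ^+ m by rewrite divr_gt0 ?side_gt0 ?exprn_gt0.
have SE : side k = 2 ^+ m * (side k / 2 ^+ m) by rewrite mulrC mulfVK// expf_neq0.
have zl : z%:~R * 2 ^+ m <= f%:~R :> R.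
  by rewrite -dR -intrM ler_int fE lerDl.
have zr : f%:~R + 1 <= (z + 1)%:~R * 2 ^+ m :> R.
  by rewrite -dR -intrM -intrD1 ler_int fE mulrDl mul1r -addrA lerD2l lezD1.
move: (side k / 2 ^+ m) SE S0 xl xr => l -> l0 xl xr.
rewrite !mulrA (le_trans _ xl) ?(lt_le_trans xr) ?ler_pM2r//.
Qed.

Lemma ancestor_grid_index_sub k m x : (k <= m)%N ->
  ancestor (m - k) (grid_index m x) = grid_index k x.
Proof. by move=> km; rewrite -{2}(subnKC km) ancestor_grid_index. Qed.

Lemma near_index_grid r k x y : near_index r (grid_index k x) (grid_index k y) ->
  forall t, `|tnth x t - tnth y t| <= r.+1%:R * side k.
Proof.
move=> xy t; have := xy t.
have /andP[] := grid_indexP k x t; have /andP[] := grid_indexP k y t.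
move: (grid_index k x t) (grid_index k y t) (tnth x t) (tnth y t) => a b u v.
have := side_gt0 k; move: (side k) => l l0 bv vb au ua ab.
have : `|a%:~R - b%:~R| <= r%:R :> R.
  by rewrite -intrB -intr_norm [leRHS](_ : _ = r%:Z%:~R)// ler_int.
rewrite -natr1 !ler_norml => /andP[ab1 ab2].
by apply/andP; split; nra.
Qed.

Lemma grid_index_near k x y : (forall t, `|tnth x t - tnth y t| < side k) ->
  near_index 1 (grid_index k x) (grid_index k y).
Proof.
move=> xy t; have := xy t.
have /andP[] := grid_indexP k x t; have /andP[] := grid_indexP k y t.
move: (grid_index k x t) (grid_index k y t) (tnth x t) (tnth y t) => a b u v.
have := side_gt0 k; move: (side k) => l l0 bv vb au ua.
rewrite ltr_norml => /andP[uv1 uv2].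
have h (c e : int) (x1 y1 : R) : x1 - y1 < l -> c%:~R * l <= x1 -> y1 < (e%:~R + 1) * l ->
    c - e <= 1.
  move=> *; rewrite -ltzD1 -(ltr_int R) intrB.
  by rewrite -(ltr_pM2r l0); nra.
rewrite ler_norml; apply/andP; split; last exact: (h a b u v).
by rewrite lerNl opprB; apply: (h b a v u) => //; lra.
Qed.

Lemma measurable_grid_cell k p : measurable (grid_index k @^-1` [set p]).
Proof.
rewrite (_ : _ @^-1` _ = \big[setI/setT]_(t < n)
   (fun x : Rn R n => tnth x t) @^-1` `[(p t)%:~R * side k, ((p t)%:~R + 1) * side k[).
  apply: bigsetI_measurable => t _; rewrite -[X in measurable X]setTI.
  exact: measurable_tnth.
rewrite -bigcap_seq; apply/seteqP; split => x /=.
  by move=> <- t _ /=; rewrite in_itv/= grid_indexP.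
move=> H; apply/ffunP => t; rewrite ffunE; apply: floor_def.
have := H t (mem_index_enum t); rewrite /= in_itv/= => /andP[xl xr].
by rewrite ler_pdivlMr ?side_gt0// ltr_pdivrMr ?side_gt0// intrD1 xl xr.
Qed.

End grid.

(** * Growth of the restricted measure *)

Section growth.
Local Open Scope ereal_scope.
Context {R : realType} (n : nat).
Implicit Types (x y z : Rn R n).

Lemma measurable_LRn (A : set (Rn R n)) :
  measurable A -> measurable (A : set (LRn R n)).
Proof. by move=> mA; apply: sub_caratheodory; exact: sub_sigma_algebra. Qed.

Lemma eball_enorm x r y : eball x r y = (enorm (fun i => tnth y i - tnth x i) < r)%R.
Proof. by []. Qed.

Lemma eball_near x r r' y z (D : R) : eball x r y ->
  (forall t, `|tnth z t - tnth y t| <= D)%R -> (r + n%:R * D <= r')%R -> eball x r' z.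
Proof.
rewrite !eball_enorm => xy yz rr'; apply: lt_le_trans rr'.
have := enormD_le (fun i => tnth y i - tnth x i)%R (fun i => tnth z i - tnth y i)%R.
under [X in enorm X]eq_fun do rewrite addrC subrKA.
move=> /le_lt_trans; apply; apply: ltr_leD => //.
apply: (@le_trans _ _ (\sum_(i < n) D)%R); first exact: ler_sum.
by rewrite sumr_const card_ord mulr_natl.
Qed.

Lemma near_eball y r z (D : R) :
  (forall t, `|tnth z t - tnth y t| <= D)%R -> (n%:R * D < r)%R -> eball y r z.
Proof.
rewrite eball_enorm => yz; apply: le_lt_trans.
apply: le_trans (enorm_le_sum _) _.
apply: (@le_trans _ _ (\sum_(i < n) D)%R); first exact: ler_sum.
by rewrite sumr_const card_ord mulr_natl.
Qed.

Lemma eball_coord y r z : eball y r z -> forall t, (`|tnth z t - tnth y t| < r)%R.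
Proof. by rewrite eball_enorm => /le_lt_trans yz t; apply: yz; exact: coord_le_enorm. Qed.

Lemma measurable_cube z (d : R) : measurable (cube z d).
Proof.
rewrite (_ : cube z d = box (fun i => tnth z i - d / 2)%R (fun i => tnth z i + d / 2)%R).
  exact: measurable_box.
by apply/seteqP; split => y yz i; have := yz i; rewrite ler_distl.
Qed.

Lemma lebesgue_Rn_cube z (d : R) : (0 <= d)%R ->
  lebesgue_Rn (cube z d : set (LRn R n)) = (d ^+ n)%:E.
Proof.
move=> d0.
rewrite (_ : cube z d = box (fun i => tnth z i - d / 2)%R (fun i => tnth z i + d / 2)%R);
  last by apply/seteqP; split => y yz i; have := yz i; rewrite ler_distl.
rewrite lebesgue_Rn_box => [|i]; last by rewrite lerD2l ge0_cp// divr_ge0.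
rewrite (eq_bigr (fun=> d)) => [|i _]; last by field.
by rewrite prodr_const card_ord.
Qed.

(** A small cube around [z] lies in the ball and has positive Lebesgue measure, so it is not
    contained in the null set where the essential bound fails. *)
Lemma exists_le_Lnorm_infty (f : Rn R n -> \bar R) x0 r0 z (D : R) :
  eball x0 r0 z -> (0 < D)%R ->
  exists y, [/\ eball x0 r0 y, forall t, (`|tnth y t - tnth z t| <= D)%R &
    f y <= 'N[@lebesgue_Rn R n]_+oo [f \_ (eball x0 r0)]].
Proof.
move=> zB D0; set B := eball x0 r0; set N := Lnorm _ _ _.
(* The denominator [n.+1] makes [n * d] smaller than the distance from [z] to the boundary
   sphere. *)
pose d := Num.min D ((r0 - enorm (fun i => tnth z i - tnth x0 i)) / n.+1%:R)%R.
have d0 : (0 < d)%R by rewrite lt_min D0 divr_gt0// subr_gt0.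
have cubeP y : cube z (2 * d) y -> forall t, (`|tnth y t - tnth z t| <= d)%R.
  by move=> yz t; have := yz t; rewrite mulrC mulKf.
have cubeB y : cube z (2 * d) y -> B y.
  move=> /cubeP yz; apply: (@eball_near x0 (r0 - n%:R * d)%R r0 z y d _ yz).
    rewrite eball_enorm ltrBrDr -ltrBrDl.
    apply: (@le_lt_trans _ _ (n%:R * ((r0 - enorm (fun i => tnth z i - tnth x0 i)) / n.+1%:R))%R).
      by apply: ler_wpM2l => //; rewrite ge_min lexx orbT.
    rewrite mulrCA gtr_pMr ?subr_gt0// ltr_pdivrMr// mul1r ltr_nat.
    by [].
  by rewrite subrK.
have N_ge : \forall y \ae @lebesgue_Rn R n, `|(f \_ B) y| <= N.
  (* The norm is an essential supremum only if the whole space has positive measure; a unit cube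
     shows that it does. *)
  rewrite /N Lnorm.unlock ifT; first exact: ess_sup_ge.
  apply: (@lt_le_trans _ _ (lebesgue_Rn (cube z 1 : set (LRn R n)))).
    by rewrite lebesgue_Rn_cube// lte_fin exprn_gt0.
  by apply: le_measure; rewrite ?inE//; apply: measurable_LRn; exact: measurable_cube.
case: N_ge => M [mM M0 NM].
apply: contrapT => noy.
have : lebesgue_Rn (cube z (2 * d) : set (LRn R n)) <= 0.
  rewrite -M0; apply: le_measure; rewrite ?inE//.
    by apply: measurable_LRn; exact: measurable_cube.
  move=> y yz; apply: NM => /= fN; apply: noy; exists y.
  have By := cubeB _ yz; split => //.
    by move=> t; apply: le_trans (cubeP _ yz t) _; rewrite ge_min lexx.
  apply: le_trans fN; rewrite patchE mem_set//; exact: lee_abs.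
rewrite lebesgue_Rn_cube ?mulr_ge0 ?(ltW d0)// lee_fin leNgt.
by rewrite exprn_gt0// mulr_gt0.
Qed.

Variables (alpha : R) (mu : {measure set (Rn R n) -> \bar R}) (x0 : Rn R n) (r0 : R).
Let muB := mrestr mu (measurable_eball x0 r0).
Let N := 'N[@lebesgue_Rn R n]_(+oo) [maxM alpha muB \_ (eball x0 r0)].

(* Compare [E] with a ball centred at a nearby point of the ball where the maximal
   function does not exceed its essential supremum. *)
Lemma mrestr_growth (E : set (Rn R n)) (D : R) : measurable E -> (0 < D)%R ->
  (forall y z, E y -> E z -> forall t, `|tnth y t - tnth z t| <= D)%R ->
  muB E <= N * ((((2 * n).+1%:R * D) `^ (n%:R - alpha))%R)%:E.
Proof.
move=> mE D0 ED; set rho := (_ * D)%R.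
have rho0 : (0 < rho)%R by rewrite mulr_gt0.
have [EB0|/set0P[z [Ez Bz]]] := eqVneq (E `&` eball x0 r0) set0.
  by rewrite /muB /mrestr EB0 measure0 mule_ge0 ?Lnorm_ge0 ?lee_fin ?powR_ge0.
have [y [By yz My]] := exists_le_Lnorm_infty (maxM alpha muB) Bz D0.
rewrite -/N in My.
apply: (@le_trans _ _ (muB (eball y rho))).
  apply: le_measure; rewrite ?inE//; first exact: measurable_eball.
  (* Through [z], the points of [E] are within [2 * D] of [y] in each coordinate, hence at distance
     at most [2 * n * D], which is less than [rho]. *)
  move=> x Ex; apply: (@near_eball _ _ _ (2 * D)%R) => [t|].
    rewrite -(subrKA (tnth z t)) (le_trans (ler_normD _ _))// mulr2n mulrDl mul1r.
    by apply: lerD; [exact: ED|rewrite distrC].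
  by rewrite /rho mulrA ltr_pM2r// -natrM mulnC ltr_nat.
have -> : muB (eball y rho) = muB (eball y rho) * (rho `^ (alpha - n%:R))%:E *
    (rho `^ (n%:R - alpha))%:E.
  by rewrite -muleA -EFinM -opprB powRN mulVf ?mule1// gt_eqF// powR_gt0.
apply: lee_wpmul2r; first by rewrite lee_fin powR_ge0.
by apply: le_trans My; apply: ereal_sup_ubound; exists rho.
Qed.

End growth.

(** * The potential as a sum over scales *)

Section dyadic_integral.
Local Open Scope ereal_scope.
Context {R : realType}.

(* Unlike [ge0_le_integral], no measurability is required. *)
Lemma le_integral_nonmeas d (T : measurableType d) (mu : {measure set T -> \bar R})
    (D : set T) (f g : T -> \bar R) :
  (forall x, D x -> 0 <= f x) -> (forall x, D x -> f x <= g x) ->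
  \int[mu]_(x in D) f x <= \int[mu]_(x in D) g x.
Proof.
move=> f0 fg; rewrite (integral_mkcond D f) (integral_mkcond D g).
have fD0 x : 0 <= (f \_ D) x by exact: erestrict_ge0.
have fgD x : (f \_ D) x <= (g \_ D) x by exact: lee_restrict.
rewrite !ge0_integralTE//; last by move=> x; exact: le_trans (fgD x).
apply: ereal_sup_le => _ [h hf <-]; exists h => //= x.
exact: le_trans (hf x) (fgD x).
Qed.

(** The height is chosen so that the integral is [C k], the interval having length [a k]. *)
Let piece (a C : nat -> R) k (r : R) : \bar R :=
  ((C k / a k)%R * \1_(`]a k, (2 * a k)%R]%classic : set R) r)%:E.

Let measurable_piece a C k : measurable_fun setT (piece a C k).
Proof.
apply: measurableT_comp => //; apply: measurable_funM => //.
Qed.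

Let piece_ge0 a C k r : (0 < a k)%R -> (0 <= C k)%R -> 0 <= piece a C k r.
Proof. by move=> a0 C0; rewrite lee_fin mulr_ge0// divr_ge0// ltW. Qed.

Let pieceE a C k r : (a k < r <= 2 * a k)%R -> piece a C k r = (C k / a k)%:E.
Proof.
by move=> ar; rewrite /piece indicE mem_set ?mulr1//= in_itv.
Qed.

Let integral_piece_le a C k : (0 < a k)%R -> (0 <= C k)%R ->
  \int[lebesgue_measure]_(r in `]0%R, +oo[) piece a C k r <= (C k)%:E.
Proof.
move=> a0 C0; rewrite /piece; under eq_integral do rewrite EFinM.
rewrite ge0_integralZl_EFin//; last 2 first.
- by apply: measurable_funTS; exact: measurableT_comp.
- by rewrite divr_ge0// ltW.
rewrite integral_indic//.
apply: (@le_trans _ _ ((C k / a k)%:E * lebesgue_measure (`]a k, (2 * a k)%R]%classic : set R))).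
  apply: lee_wpmul2l; first by rewrite lee_fin divr_ge0// ltW.
  by apply: le_measure; rewrite ?inE//; exact: measurableI.
rewrite lebesgue_measure_itv/= lte_fin ltr_pMl// ltr1n -EFinB -EFinM lee_fin.
by rewrite mulrDl mul1r addrK divfK// gt_eqF.
Qed.

(** The function [f] is dominated by the sum of all the step functions, which is integrated term by
    term. The two families serve the small and the large radii. *)
Lemma integral_dyadic_le (f : R -> \bar R) (a b C D : nat -> R) :
  (forall k, 0 < a k)%R -> (forall k, 0 < b k)%R ->
  (forall k, 0 <= C k)%R -> (forall k, 0 <= D k)%R ->
  (forall r, (0 < r)%R -> 0 <= f r) ->
  (forall r, (0 < r)%R ->
    (exists2 k, (a k < r <= 2 * a k)%R & f r <= (C k / a k)%:E) \/
    (exists2 k, (b k < r <= 2 * b k)%R & f r <= (D k / b k)%:E)) ->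
  \int[lebesgue_measure]_(r in `]0%R, +oo[) f r <= \sum_(k <oo) (C k + D k)%:E.
Proof.
move=> a0 b0 C0 D0 f0 fab.
pose g k r := piece a C k r + piece b D k r.
have pa0 k r : 0 <= piece a C k r by exact: piece_ge0.
have pb0 k r : 0 <= piece b D k r by exact: piece_ge0.
have g0 k r : 0 <= g k r by exact: adde_ge0.
have sumg0 k r : 0 <= \sum_(0 <= i < k) g i r by exact: sume_ge0.
apply: (@le_trans _ _ (\int[lebesgue_measure]_(r in `]0%R, +oo[) \sum_(k <oo) g k r)).
  apply: le_integral_nonmeas => r /=; rewrite in_itv/= andbT => r0; first exact: f0.
  have [[k kr fk]|[k kr fk]] := fab r r0; apply: le_trans fk _.
    rewrite -(pieceE C kr); apply: le_trans (nneseries_lim_ge k.+1 _) => //.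
    by rewrite big_nat_recr//= -[g k r]/(_ + _) addeCA leeDl// adde_ge0.
  rewrite -(pieceE D kr); apply: le_trans (nneseries_lim_ge k.+1 _) => //.
  by rewrite big_nat_recr//= -[g k r]/(_ + _) addeA leeDr// adde_ge0.
rewrite integral_nneseries//; last first.
  by move=> k; apply: measurable_funTS; apply: emeasurable_funD; exact: measurable_piece.
apply: lee_nneseries => [k|k _].
  by move=> *; apply: integral_ge0.
rewrite /g ge0_integralD//; [|apply: measurable_funTS; exact: measurable_piece..].
by rewrite EFinD; apply: leeD; exact: integral_piece_le.
Qed.

Lemma exists_dyadic_le (s r : R) : (0 < s)%R -> (0 < r)%R ->
  (exists k, s / 2 / 2 ^+ k.+1 < r <= s / 2 / 2 ^+ k)%R \/
  (exists k, s / 2 * 2 ^+ k < r <= s / 2 * 2 ^+ k.+1)%R.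
Proof.
move=> s0 r0; set h := (s / 2)%R; have h0 : (0 < h)%R by rewrite divr_gt0.
have pow_gt (x : R) : exists k, (x <= 2 ^+ k)%R.
  exists (Num.bound `|x|); apply: le_trans (ler_norm x) _.
  apply: le_trans (ltW (archi_boundP (normr_ge0 x))) _.
  by rewrite -natrX ler_nat ltnW// ltn_expl.
have [rh|hr] := leP r h.
  left; have [k0 hk0] := pow_gt (h / r)%R.
  have ex : exists k, (h / 2 ^+ k.+1 < r)%R.
    exists k0; rewrite ltr_pdivrMr ?exprn_gt0// mulrC -ltr_pdivrMr//.
    by apply: le_lt_trans hk0 _; rewrite ltr_eXn2l// ltr1n.
  case: (ex_minnP ex) => -[|k] hkr kmin; first by exists 0%N; rewrite hkr expr0 divr1.
  exists k.+1; rewrite hkr leNgt; apply/negP => /kmin.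
  by rewrite ltnn.
right; have [k0 hk0] := pow_gt (r / h)%R.
have ex : exists k, (r <= h * 2 ^+ k.+1)%R.
  exists k0; rewrite mulrC -ler_pdivrMr//; apply: le_trans hk0 _.
  by rewrite ler_eXn2l// ltr1n.
case: (ex_minnP ex) => -[|k] rhk kmin; first by exists 0%N; rewrite rhk expr0 mulr1 hr.
exists k.+1; rewrite rhk andbT ltNge; apply/negP => /kmin.
by rewrite ltnn.
Qed.

(** A radius up to [s / 2] lies between some [side s k.+2] and [side s k.+1], where [phi] is at most
    [u k]. Beyond [s / 2] only the total bound [V] is used, and the power of [r] provides the
    decay. *)
Lemma dyadic_potential_le (phi : R -> \bar R) (gamma q s V : R) (u : nat -> R) :
  (0 < gamma)%R -> (0 < q)%R -> (0 < s)%R ->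
  (forall r, 0 <= phi r) -> {homo phi : r r' / (r <= r')%R >-> r <= r'} ->
  (forall r, phi r <= V%:E) -> (forall k, phi (side s k.+1) <= (u k)%:E) ->
  \int[lebesgue_measure]_(r in `]0%R, +oo[)
     ((phi r / (r `^ gamma)%:E) `^ q * (r^-1)%:E) <=
  \sum_(k <oo) ((u k / side s k.+2 `^ gamma) `^ q +
                (V / (s / 2 * 2 ^+ k) `^ gamma) `^ q)%:E.
Proof.
move=> gamma0 q0 s0 phi0 phi_nd phiV phiu.
have V0 : (0 <= V)%R by rewrite -lee_fin (le_trans (phi0 1%R)).
have u0 k : (0 <= u k)%R by rewrite -lee_fin (le_trans (phi0 (side s k.+1))).
have side2 k : side s k.+1 = (s / 2 / 2 ^+ k)%R.
  by rewrite /side exprS invfM mulrA.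
have bound (a r c : R) : (0 < a)%R -> (a < r)%R -> phi r <= c%:E ->
    (phi r / (r `^ gamma)%:E) `^ q * (r^-1)%:E <= ((c / a `^ gamma) `^ q / a)%:E.
  move=> a0 ar phic; have r0 := lt_trans a0 ar.
  have c0 : (0 <= c)%R by rewrite -lee_fin (le_trans (phi0 r)).
  rewrite EFinM; apply: lee_pmul; first exact: poweR_ge0.
  - by rewrite lee_fin invr_ge0 ltW.
  - rewrite -(poweR_EFin (c / _)) inver gt_eqF ?powR_gt0//.
    apply: (gt0_ler_poweR (ltW q0)); rewrite ?in_itv/= ?leey ?andbT.
    + by rewrite mule_ge0// lee_fin invr_ge0 powR_ge0.
    + by rewrite lee_fin divr_ge0// powR_ge0.
    rewrite EFinM; apply: lee_pmul => //; first by rewrite lee_fin invr_ge0 powR_ge0.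
    rewrite lee_fin lef_pV2 ?posrE ?powR_gt0//.
    by rewrite ge0_ler_powR ?(ltW gamma0)// ?nnegrE ltW.
  - by rewrite lee_fin lef_pV2 ?posrE// ltW.
apply: (@integral_dyadic_le _ (fun k => side s k.+2) (fun k => s / 2 * 2 ^+ k)%R).
- by move=> k; exact: side_gt0.
- by move=> k; rewrite mulr_gt0 ?divr_gt0// exprn_gt0.
- by move=> k; exact: powR_ge0.
- by move=> k; exact: powR_ge0.
- by move=> r r0; rewrite mule_ge0 ?poweR_ge0// lee_fin invr_ge0 ltW.
move=> r r0; have [[k /andP[kr rk]]|[k /andP[kr rk]]] := exists_dyadic_le s0 r0.
  left; exists k; first by rewrite !side2 kr/= (le_trans rk)// exprS invfM mulrCA mulVKf.
  apply: bound; [exact: side_gt0|by rewrite side2|].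
  by apply: le_trans (phiu k); apply: phi_nd; rewrite side2.
right; exists k; first by rewrite kr (le_trans rk)// exprS mulrCA.
by apply: bound => //; rewrite mulr_gt0 ?divr_gt0// exprn_gt0.
Qed.

End dyadic_integral.

(** * Exponentials of series and of small numbers *)

Section expeR_series.
Local Open Scope ereal_scope.
Context {R : realType}.

(** After division by [b], the partial sums are bounded by a logarithm, and this bound passes to the
    limit. The values [0] and [+oo] are treated apart; for [b = +oo] the case [J = 0] already forces
    [L = +oo]. *)
Lemma expeR_nneseries_le (a : nat -> R) (b L : \bar R) :
  (forall k, 0 <= a k)%R -> 0 <= b ->
  (forall J, (expR (\sum_(k < J) a k))%:E * b <= L) ->
  expeR (\sum_(k <oo) (a k)%:E) * b <= L.
Proof.
move=> a0 b0 aL.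
have L0 : 0 <= L by apply: le_trans (aL 0%N); rewrite mule_ge0// lee_fin expR_ge0.
have [->|b_neq0] := eqVneq b 0; first by rewrite mule0.
have b_gt0 : 0 < b by rewrite lt0e b_neq0.
have [by_|bfin] := eqVneq b +oo.
  have := aL 0%N; rewrite big_ord0 expR0 mul1e by_ leye_eq => /eqP ->.
  by rewrite leey.
have {}bfin : b \is a fin_num by rewrite ge0_fin_numE// lt_neqAle bfin leey.
rewrite -(fineK bfin) in aL b_gt0 *; move: (fine b) aL b_gt0 => r aL; rewrite lte_fin => r0.
have {}aL J : (expR (\sum_(k < J) a k))%:E <= L * (r^-1)%:E.
  by rewrite lee_pdivlMr.
rewrite -lee_pdivlMr//; move: (L * _) aL => M aM.
have M_gt0 : 0 < M by apply: lt_le_trans (aM 0%N); rewrite lte_fin expR_gt0.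
case: M aM M_gt0 => [m|_ _|//]; last by rewrite leey.
move=> am; rewrite lte_fin => m0.
rewrite -[m](@lnK R)// -[X in _ <= X]/(expeR (ln m)%:E) lee_expeR.
apply: lime_le; first by apply: is_cvg_nneseries => k _ _; rewrite lee_fin.
apply: nearW => J; rewrite big_mkord sumEFin lee_fin.
by rewrite -ler_expR lnK// -lee_fin.
Qed.

End expeR_series.

(** From [1 - t <= expR (- t)], the exponential is at most [(1 - t)^-1], which is at most
    [1 + 2 * t] up to [t = 1/2]. *)
Lemma expR_le1D2x {R : realType} (t : R) : 0 <= t -> t <= 2^-1 -> expR t <= 1 + 2 * t.
Proof.
move=> t0 t2; have h : 1 - t <= expR (- t) by exact: expR_ge1Dx.
have t1 : 0 < 1 - t by lra.
have : expR t <= (1 - t)^-1 by rewrite -[t in expR t]opprK expRN lef_pV2// posrE ?expR_gt0.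
move=> /le_trans; apply; rewrite -div1r ler_pdivrMr//; nra.
Qed.

(** * The weight on the cells of the grid *)

Section weighted_grid.
Local Open Scope ereal_scope.
Context {R : realType} (n : nat) (s : R).
Hypothesis s_gt0 : (0 < s)%R.
Local Notation I := {ffun 'I_n -> int}.
Local Notation cell k p := (grid_index s k @^-1` [set p]).
Variables (Cs theta : R) (sigma : LRn R n -> \bar R).
Hypotheses (Cs_ge0 : (0 <= Cs)%R) (theta_ge0 : (0 <= theta)%R).
Hypothesis sigma_Ainfty : weak_Ainfty Cs theta sigma.

Lemma measurable_sigma : measurable_fun setT sigma. Proof. by case: sigma_Ainfty. Qed.

Lemma sigma_ge0 x : 0 <= sigma x. Proof. by case: sigma_Ainfty. Qed.

Lemma wmeas_ge0 A : 0 <= wmeas sigma A.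
Proof. by apply: integral_ge0 => x _; exact: sigma_ge0. Qed.

Lemma le_wmeas (A B : set (LRn R n)) : measurable A -> measurable B -> A `<=` B ->
  wmeas sigma A <= wmeas sigma B.
Proof.
move=> mA mB AB; apply: ge0_subset_integral => //.
  by apply: measurable_funTS; exact: measurable_sigma.
by move=> x _; exact: sigma_ge0.
Qed.

Lemma measurable_cell_LRn k p : measurable (cell k p : set (LRn R n)).
Proof. by apply: measurable_LRn; exact: measurable_grid_cell. Qed.

Lemma measurable_grid_set k (S : set I) :
  measurable (grid_index s k @^-1` S : set (LRn R n)).
Proof. by apply: measurable_preimage_countType => p; exact: measurable_cell_LRn. Qed.

Definition cell_weight k p := wmeas sigma (cell k p).

Lemma cell_weight_ge0 k p : 0 <= cell_weight k p. Proof. exact: wmeas_ge0. Qed.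

Lemma wmeas_grid_set k (S : set I) :
  wmeas sigma (grid_index s k @^-1` S) = \esum_(p in S) cell_weight k p.
Proof.
apply: (@ge0_integral_preimage_esum _ (LRn R n)).
- by move=> i; exact: measurable_cell_LRn.
- exact: measurable_sigma.
- exact: sigma_ge0.
Qed.

Lemma cell_children k m (i : I) :
  cell k i = grid_index s (k + m) @^-1` (ancestor m @^-1` [set i]).
Proof. by apply/seteqP; split => x; rewrite /preimage/= ancestor_grid_index. Qed.

Lemma cell_weight_children k i :
  cell_weight k i = \esum_(p in ancestor 1 @^-1` [set i]) cell_weight k.+1 p.
Proof. by rewrite -wmeas_grid_set -addn1 -cell_children. Qed.

Definition cell_center k (p : I) : Rn R n :=
  [tuple (((p t)%:~R + 2^-1) * side s k)%R | t < n].

Lemma cell_sub_cube k p : cell k p `<=` cube (cell_center k p) (side s k).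
Proof.
move=> x <- t; rewrite tnth_mktuple; have := grid_indexP s_gt0 k x t.
move: (grid_index s k x t) => z /andP[zl zr]; rewrite ler_norml.
by apply/andP; split; lra.
Qed.

(** The double sticks out of the cell by half a side, hence reaches adjacent cells only; so the
    doubled cube of the weak A_infty condition is controlled by [near_sum 1]. *)
Lemma double_cube_sub_near k p :
  cube (cell_center k p) (2 * side s k) `<=` grid_index s k @^-1` near_index 1 p.
Proof.
move=> x xp t; have := xp t; rewrite tnth_mktuple.
have /andP[] := grid_indexP s_gt0 k x t.
move: (grid_index s k x t) (p t) (tnth x t) => a b u au ua.
have := side_gt0 s_gt0 k; move: (side s k) au ua => l au ua l0.
rewrite mulrAC divff// mul1r ler_norml => /andP[bu ub].
rewrite ler_norml; apply/andP; split.
  rewrite lerBrDr addrC lerBlDr -ltzD1 -(ltr_int R) !intrD -(ltr_pM2r l0).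
  nra.
rewrite lerBlDr -ltzD1 -(ltr_int R) !intrD -(ltr_pM2r l0).
nra.
Qed.

Lemma lebesgue_cell_le k p : lebesgue_Rn (cell k p : set (LRn R n)) <= (side s k ^+ n)%:E.
Proof.
have sk0 := side_gt0 s_gt0 k.
rewrite -(lebesgue_Rn_cube (cell_center k p)) ?(ltW sk0)//.
apply: le_measure; rewrite ?inE;
  [exact: measurable_cell_LRn| |exact: cell_sub_cube].
by apply: measurable_LRn; exact: measurable_cube.
Qed.

(** At most [c] cells of generation [k + m] fill at most the proportion [c / 2 ^+ (m * n)] of the
    closed cube around the cell [i], to which the weak A_infty condition is applied. *)
Lemma cell_weight_Ainfty k m i (S : set I) (c : R) :
  S `<=` ancestor m @^-1` [set i] -> (0 <= c)%R -> \esum_(p in S) 1 <= c%:E ->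
  \esum_(p in S) cell_weight (k + m)%N p <=
    (Cs * (c / 2 ^+ (m * n)) `^ theta)%:E * near_sum 1 (cell_weight k) i.
Proof.
move=> Si c0 Sc; rewrite -wmeas_grid_set.
have sk0 := side_gt0 s_gt0 k; have skm0 := side_gt0 s_gt0 (k + m).
have [_ _ Ainf] := sigma_Ainfty.
set E : set (LRn R n) := _ @^-1` S.
have Ecube : E `<=` cube (cell_center k i) (side s k).
  move=> x /Si xi; apply: cell_sub_cube.
  by rewrite /preimage/= -(ancestor_grid_index s_gt0 k m).
apply: le_trans (Ainf _ _ E sk0 (measurable_grid_set _ _) Ecube) _.
apply: lee_pmul; [by rewrite mule_ge0 ?poweR_ge0 ?lee_fin|exact: wmeas_ge0| |]; last first.
  rewrite -[near_sum _ _ _]wmeas_grid_set; apply: le_wmeas.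
  - by apply: measurable_LRn; exact: measurable_cube.
  - exact: measurable_grid_set.
  - exact: double_cube_sub_near.
rewrite EFinM; apply: lee_wpmul2l; first by rewrite lee_fin.
rewrite lebesgue_Rn_cube ?(ltW sk0)// inver gt_eqF ?exprn_gt0//.
rewrite -poweR_EFin; apply: (gt0_ler_poweR theta_ge0).
- by rewrite in_itv/= leey andbT mule_ge0// lee_fin invr_ge0 exprn_ge0// ltW.
- by rewrite in_itv/= leey andbT lee_fin divr_ge0// exprn_ge0.
have -> : (c / 2 ^+ (m * n))%:E = (c * side s (k + m) ^+ n)%:E * (side s k ^- n)%:E.
  rewrite -EFinM sideD expr_div_n -exprM; congr (_%:E).
  by field; rewrite !expf_neq0 ?gt_eqF.
apply: lee_wpmul2r; first by rewrite lee_fin invr_ge0 exprn_ge0// ltW.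
rewrite /E (@measure_preimage_esum _ (LRn R n) R); last by move=> p; exact: measurable_cell_LRn.
apply: (@le_trans _ _ (\esum_(p in S) ((side s (k + m) ^+ n)%:E * 1))).
  by apply: le_esum => p _; rewrite mule1; exact: lebesgue_cell_le.
rewrite esumZl ?exprn_ge0 ?(ltW skm0)// mulrC EFinM.
by apply: lee_wpmul2l; rewrite ?lee_fin ?exprn_ge0 ?(ltW skm0).
Qed.

End weighted_grid.

(** * The potential bounded by cell masses *)

Section potential_grid.
Local Open Scope ereal_scope.
Context {R : realType} (n : nat).
Local Notation I := {ffun 'I_n -> int}.
Variables (alpha q s N V : R) (nu : {measure set (Rn R n) -> \bar R}).
Let gamma : R := (n%:R - alpha)%R.
Local Notation cell k p := (grid_index s k @^-1` [set p]).
Hypotheses (s_gt0 : (0 < s)%R) (N_gt0 : (0 < N)%R) (q_gt0 : (0 < q)%R).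
Hypothesis gamma_gt0 : (0 < gamma)%R.
Hypothesis nu_growth : forall (E : set (Rn R n)) D, measurable E -> (0 < D)%R ->
  (forall y z, E y -> E z -> forall t, `|tnth y t - tnth z t| <= D)%R ->
  nu E <= (N * ((2 * n).+1%:R * D) `^ gamma)%:E.
Hypothesis nu_total : nu setT <= V%:E.

(** Measuring masses in this unit removes [N] and [s] from the growth bound, leaving a constant that
    depends on [n] and [alpha] only. *)
Definition mass_unit : R := (N * s `^ gamma)%R.

Definition cell_mass k (p : I) := (mass_unit^-1)%:E * nu (cell k p).

Let kappa : R := (2 `^ gamma)%R.

Lemma mass_unit_gt0 : (0 < mass_unit)%R.
Proof. by rewrite mulr_gt0// powR_gt0. Qed.

Let massV_ge0 : (0 <= mass_unit^-1)%R.
Proof. by rewrite invr_ge0 ltW// mass_unit_gt0. Qed.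

Lemma cell_mass_ge0 k p : 0 <= cell_mass k p.
Proof. by rewrite mule_ge0. Qed.

Lemma esum_cell_mass k (S : set I) :
  \esum_(p in S) cell_mass k p = (mass_unit^-1)%:E * nu (grid_index s k @^-1` S).
Proof.
rewrite esumZl// (@measure_preimage_esum _ _ R)// => p.
exact: measurable_grid_cell.
Qed.

Lemma cell_mass_children k i :
  cell_mass k i = \esum_(p in ancestor 1 @^-1` [set i]) cell_mass k.+1 p.
Proof. by rewrite esum_cell_mass /cell_mass (cell_children s_gt0 k 1) addn1. Qed.

Lemma side_powR k : (side s k `^ gamma = s `^ gamma * kappa ^- k)%R.
Proof.
rewrite /side powRM ?invr_ge0 ?exprn_ge0 ?(ltW s_gt0)//; congr (_ * _)%R.
rewrite -powR_inv1 ?exprn_ge0// powRAC powR_inv1 ?powR_ge0//; congr (_^-1)%R.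
by rewrite -(@powR_mulrn _ 2)// powRAC powR_mulrn ?powR_ge0.
Qed.

Lemma measurable_near_set r k p : measurable (grid_index s k @^-1` near_index r p : set (Rn R n)).
Proof. by apply: measurable_preimage_countType => i; exact: measurable_grid_cell. Qed.

(** Two points of the dilate [near_index 2 p] have indices at distance at most 4, so their
    coordinates differ by at most 5 sides; the other factor comes from [nu_growth]. *)
Definition growth_const : R := (((2 * n).+1%:R * 5) `^ gamma)%R.

Lemma cell_mass_growth k p :
  near_sum 2 (cell_mass k) p <= (growth_const * kappa ^- k)%:E.
Proof.
rewrite [leLHS]esum_cell_mass.
have sk0 := side_gt0 s_gt0 k.
have := @nu_growth (grid_index s k @^-1` near_index 2 p) (5 * side s k)%R.
move=> /(_ (measurable_near_set 2 k p)) /(_ (mulr_gt0 _ sk0)) h.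
apply: le_trans (lee_wpmul2l _ (h _ _)) _ => //.
  move=> y z yp zp; apply: (near_index_grid s_gt0).
  exact: near_index_trans (near_index_sym yp) zp.
rewrite -EFinM lee_fin (mulrA (2 * n).+1%:R) (powRM _ (mulr_ge0 _ _) (ltW sk0))// side_powR.
rewrite le_eqVlt; apply/orP; left; apply/eqP; rewrite /mass_unit /growth_const.
field; rewrite !gt_eqF// ?exprn_gt0// ?powR_gt0//.
Qed.

Local Notation dens := (density cell_mass kappa).

Lemma near_sum1_mass_fin_num k p : near_sum 1 (cell_mass k) p \is a fin_num.
Proof.
rewrite ge0_fin_numE ?near_sum_ge0//; last exact: cell_mass_ge0.
have pp : near_index 1 p p by move=> t; rewrite subrr normr0.
have := @le_near_sum R n 1 1 (cell_mass k) _ _ pp.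
by move=> /le_lt_trans; apply; apply: le_lt_trans (cell_mass_growth k p) _; rewrite ltry.
Qed.

(** A ball whose radius is one side meets only the cell of its center and the adjacent cells. *)
Lemma nu_eball_le k (x : Rn R n) :
  nu (eball x (side s k)) <= (N * side s k `^ gamma * dens 1 k (grid_index s k x))%:E.
Proof.
apply: (@le_trans _ _ (nu (grid_index s k @^-1` near_index 1 (grid_index s k x)))).
  apply: le_measure; rewrite ?inE; [exact: measurable_eball|exact: measurable_near_set|].
  move=> y /eball_coord xy; apply: (grid_index_near s_gt0) => t.
  by rewrite distrC.
have fin := near_sum1_mass_fin_num k (grid_index s k x).
have kap0 : (0 < kappa)%R by rewrite powR_gt0.
have -> : (N * side s k `^ gamma * dens 1 k (grid_index s k x))%R =
   (mass_unit * fine (near_sum 1 (cell_mass k) (grid_index s k x)))%R.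
  rewrite /density side_powR /mass_unit; field.
  by rewrite expf_neq0// gt_eqF.
rewrite EFinM fineK// [X in _ * X]esum_cell_mass muleA -EFinM mulfV ?mul1e//.
by rewrite gt_eqF// mass_unit_gt0.
Qed.

Lemma dens_eq0 k (p : I) : nu (grid_index s k @^-1` near_index 1 p) = 0 -> dens 1 k p = 0%R.
Proof. by rewrite /density [near_sum _ _ _]esum_cell_mass => ->; rewrite mule0 mul0r. Qed.

(** The term of the radii just above [s / 2], with all the mass inside; the terms of larger radii
    decrease from it geometrically. *)
Definition tail_const : R := ((V / (N * (s / 2) `^ gamma)) `^ q)%R.

Definition energy k (p : I) : R := (dens 1 k p `^ q)%R.

Lemma potT_le (c : R) (x : Rn R n) : (0 <= c)%R ->
  (c%:E * (potT alpha q nu x / N%:E)) `^ q <=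
  \sum_(k <oo) (c `^ q * (kappa `^ q * energy k.+1 (grid_index s k.+1 x) +
                         tail_const * (kappa^-1 `^ q) ^+ k))%:E.
Proof.
move=> c0.
have kap0 : (0 < kappa)%R by rewrite powR_gt0.
have V0 : (0 <= V)%R by rewrite -lee_fin (le_trans _ nu_total).
pose u k := (N * side s k.+1 `^ gamma * dens 1 k.+1 (grid_index s k.+1 x))%R.
have dens0 k p : (0 <= dens 1 k p)%R.
  by rewrite mulr_ge0 ?exprn_ge0 ?(ltW kap0)// fine_ge0// near_sum_ge0// => ?; exact: cell_mass_ge0.
have := @dyadic_potential_le R (fun r => nu (eball x r)) gamma q s V u
  gamma_gt0 q_gt0 s_gt0 _ _ _ _.
move=> /(_ (fun=> measure_ge0 _ _)) h.
have {}h := h _ _ _.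
(* The outer power [q] cancels the root in [potT], leaving the integral itself. *)
have -> : (c%:E * (potT alpha q nu x / N%:E)) `^ q = ((c / N) `^ q)%:E *
  (\int[lebesgue_measure]_(r in `]0%R, +oo[)
     ((nu (eball x r) / (r `^ gamma)%:E) `^ q * (r^-1)%:E)).
  set Phi := (X in _ = _ * X).
  have Phi0 : 0 <= Phi.
    apply: integral_ge0 => r /=; rewrite in_itv/= andbT => r0.
    by rewrite mule_ge0 ?poweR_ge0// lee_fin invr_ge0 ltW.
  rewrite /potT -/gamma -/Phi inver gt_eqF// muleCA -EFinM muleC.
  rewrite poweRM ?poweR_ge0 ?lee_fin ?divr_ge0 ?(ltW N_gt0)//.
  by rewrite -poweRrM mulVf ?gt_eqF// poweRe1.
apply: le_trans (lee_wpmul2l _ (h _ _ _)) _.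
- by rewrite lee_fin powR_ge0.
- move=> r r' rr'; apply: le_measure; rewrite ?inE; [exact: measurable_eball..|].
  by move=> y; rewrite !eball_enorm => /lt_le_trans; apply.
- move=> r; apply: le_trans nu_total; apply: le_measure; rewrite ?inE//.
  exact: measurable_eball.
- by move=> k; exact: nu_eball_le.
rewrite -nneseriesZl; last first.
  by move=> k _; rewrite lee_fin addr_ge0// powR_ge0.
apply: lee_nneseries => [k _ _|k _].
  by rewrite mule_ge0// lee_fin ?addr_ge0// ?powR_ge0.
rewrite -EFinM lee_fin powRM ?invr_ge0 ?(ltW N_gt0)// -[leLHS]mulrA.
apply: ler_wpM2l; first exact: powR_ge0.
rewrite mulrDr le_eqVlt; apply/orP; left; apply/eqP; congr (_ + _)%R.
  rewrite /energy /u; move: (dens _ _ _) (dens0 k.+1 (grid_index s k.+1 x)) => d d0.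
  rewrite -!powRM ?invr_ge0 ?divr_ge0 ?mulr_ge0 ?powR_ge0 ?(ltW N_gt0) ?(ltW kap0)//.
  congr (_ `^ _)%R; rewrite !side_powR [in (kappa ^+ k.+2)%R]exprS.
  by field; rewrite expf_neq0 ?gt_eqF// ?powR_gt0.
rewrite /tail_const.
have -> : (((kappa^-1 `^ q) ^+ k) = (kappa^-1 ^+ k) `^ q :> R)%R.
  rewrite -powR_mulrn ?powR_ge0// -(@powR_mulrn _ kappa^-1) ?invr_ge0 ?(ltW kap0)//.
  by rewrite powRAC.
rewrite -!powRM ?invr_ge0 ?exprn_ge0 ?divr_ge0 ?mulr_ge0 ?powR_ge0 ?invr_ge0 ?(ltW N_gt0) ?(ltW kap0)//.
congr (_ `^ _)%R.
rewrite powRM ?divr_ge0 ?exprn_ge0 ?(ltW s_gt0)//.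
have -> : ((2 ^+ k) `^ gamma = kappa ^+ k :> R)%R.
  by rewrite -(@powR_mulrn _ 2)// powRAC powR_mulrn ?powR_ge0.
rewrite exprVn; field.
by rewrite !gt_eqF ?exprn_gt0 ?powR_gt0// divr_gt0.
Qed.

End potential_grid.

Lemma powR2_gt1 {R : realType} (p : R) : 0 < p -> 1 < 2 `^ p.
Proof.
move=> p0; rewrite [ltLHS](_ : 1 = 1 `^ p); last by rewrite powR1.
by rewrite gt0_ltr_powR// ?nnegrE ?ltr1n.
Qed.

(** * Exponential integrability *)

Section exponential_integrability.
Local Open Scope ereal_scope.
Context {R : realType} (n : nat).
Local Notation I := {ffun 'I_n -> int}.
Variables (alpha q s N V Cs theta : R) (x0 : Rn R n) (r0 : R).
Variables (nu : {measure set (Rn R n) -> \bar R}) (sigma : LRn R n -> \bar R).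
Let gamma : R := (n%:R - alpha)%R.
Let kappa : R := (2 `^ gamma)%R.
Let beta : R := (2 `^ (alpha / 2))%R.
Local Notation cell k p := (grid_index s k @^-1` [set p]).
Hypotheses (s_gt0 : (0 < s)%R) (N_gt0 : (0 < N)%R) (q_gt0 : (0 < q)%R).
Hypotheses (alpha_gt0 : (0 < alpha)%R) (gamma_gt0 : (0 < gamma)%R).
Hypotheses (Cs_gt0 : (0 < Cs)%R) (theta_gt0 : (0 < theta)%R).
Hypothesis nu_growth : forall (E : set (Rn R n)) D, measurable E -> (0 < D)%R ->
  (forall y z, E y -> E z -> forall t, `|tnth y t - tnth z t| <= D)%R ->
  nu E <= (N * ((2 * n).+1%:R * D) `^ gamma)%:E.
Hypothesis nu_total : nu setT <= V%:E.
Hypothesis nu_supp : forall E : set (Rn R n), E `&` eball x0 r0 = set0 -> nu E = 0.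
Hypothesis sigma_Ainfty : weak_Ainfty Cs theta sigma.
Hypothesis s_small : (n%:R * (4 * s) <= r0)%R.
Variables (c K : R).
Hypothesis c_ge0 : (0 <= c)%R.
Hypothesis decay_K : forall m,
  (\sum_(l < m) decay n q theta Cs (growth_const n alpha) beta l <= K)%R.
Hypothesis cK : (2 * c * 9 ^+ n * K <= 1)%R.
Hypothesis c_growth : (c * growth_const n alpha `^ q <= 1)%R.

Local Notation energy_at l x := (energy alpha q s N nu l (grid_index s l x)).
Local Notation B2 := (eball x0 (2 * r0) : set (LRn R n)).

Definition energy_prod J k (x : LRn R n) : R :=
  (\prod_(k <= l < J) (1 + c * energy_at l.+1 x))%R.

Let sigma0 x : 0 <= sigma x. Proof. exact: sigma_ge0 sigma_Ainfty x. Qed.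

Let msigma : measurable_fun setT sigma. Proof. exact: measurable_sigma sigma_Ainfty. Qed.

Let mB2 : measurable B2. Proof. by apply: measurable_LRn; exact: measurable_eball. Qed.

Let kappa_gt0 : (0 < kappa)%R. Proof. exact: powR_gt0. Qed.

Let growth_gt0 : (0 < growth_const n alpha)%R.
Proof. by rewrite powR_gt0// mulr_gt0. Qed.

Lemma energy_ge0 k p : (0 <= energy alpha q s N nu k p)%R.
Proof. exact: powR_ge0. Qed.

Lemma energy_le k p : (energy alpha q s N nu k p <= growth_const n alpha `^ q)%R.
Proof.
have m0 := cell_mass_ge0 alpha nu s_gt0 N_gt0.
have mg := cell_mass_growth s_gt0 N_gt0 nu_growth.
have pp : near_index 1 p p by move=> t; rewrite subrr normr0.
apply: ge0_ler_powR; rewrite ?nnegrE ?(ltW q_gt0) ?(ltW growth_gt0)//.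
  exact: density_ge0.
apply: le_trans (density1_le m0 mg kappa_gt0 _ pp) _.
exact: (density2_le m0 mg kappa_gt0).
Qed.

Lemma energy_prod_ge0 J k x : (0 <= energy_prod J k x)%R.
Proof.
by apply: prodr_ge0 => l _; rewrite addr_ge0// mulr_ge0// energy_ge0.
Qed.

(** The product depends on [x] only through its cell of generation [J], whose ancestors give all the
    coarser cells. *)
Let measurable_energy_prod J k :
  measurable_fun setT (fun x : LRn R n => (energy_prod J k x)%:E).
Proof.
pose h (p : I) : \bar R := (\prod_(k <= l < J)
  (1 + c * energy alpha q s N nu l.+1 (ancestor (J - l.+1) p)))%:E.
have hE x : (energy_prod J k x)%:E = h (grid_index s J x).
  rewrite /h /energy_prod; apply: (f_equal EFin).
  apply: eq_big_nat => l /andP[_ lJ].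
  by rewrite (ancestor_grid_index_sub s_gt0 x lJ).
rewrite (funext hE).
apply: (@measurable_fun_comp_countType _ (LRn R n) I (grid_index s J)) => p.
exact: measurable_cell_LRn.
Qed.

Let weighted J k (x : LRn R n) : \bar R := (energy_prod J k x)%:E * sigma x.

Let weighted_ge0 J k x : 0 <= weighted J k x.
Proof. by rewrite mule_ge0// lee_fin energy_prod_ge0. Qed.

Let measurable_weighted J k : measurable_fun setT (weighted J k).
Proof. exact: (emeasurable_funM (measurable_energy_prod J k) msigma). Qed.

Let cell_integral J k (i : I) : \bar R :=
  \int[@lebesgue_Rn R n]_(x in (cell k i : set (LRn R n))) weighted J k x.

Let cell_integral_rec J k i : (k < J)%N ->
  cell_integral J k i = \esum_(p in ancestor 1 @^-1` [set i])
     ((1 + c * energy alpha q s N nu k.+1 p)%:E * cell_integral J k.+1 p).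
Proof.
move=> kJ; rewrite /cell_integral (cell_children s_gt0 k 1) addn1.
rewrite (@ge0_integral_preimage_esum _ (LRn R n) R I (grid_index s k.+1))//; last first.
  by move=> p; exact: measurable_cell_LRn.
apply: eq_esum => p _; rewrite -ge0_integralZl_EFin//; last 3 first.
- exact: measurable_cell_LRn.
- exact: measurable_funTS.
- by rewrite addr_ge0// mulr_ge0// energy_ge0.
apply: eq_integral => x; rewrite inE /= => <-.
by rewrite /weighted /energy_prod big_ltn// EFinM muleA.
Qed.

Lemma cell_integral_le J i :
  \int[@lebesgue_Rn R n]_(x in (cell 0 i : set (LRn R n)))
     ((energy_prod J 0 x)%:E * sigma x) <=
  2%:E * near_sum 1 (cell_weight s sigma 0) i.
Proof.
have beta_gt1 : (1 < beta)%R.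
  by rewrite powR2_gt1// divr_gt0.
have kappa_beta : (kappa * beta ^+ 2 = 2 ^+ n)%R.
  rewrite -powR_mulrn ?powR_ge0// -powRrM divfK// -powRD ?pnatr_eq0 ?implybT//.
  by rewrite /gamma subrK powR_mulrn.
apply: (@product_le R n (cell_weight s sigma) (cell_mass alpha s N nu) q theta Cs
  (growth_const n alpha) kappa beta _ _ _ _ _ _ q_gt0 Cs_gt0 growth_gt0 kappa_gt0
  beta_gt1 kappa_beta c (cell_integral J) J _ _ _ _ K 0 i).
- exact: (@cell_weight_ge0 R n s Cs theta sigma sigma_Ainfty).
- exact: cell_mass_ge0.
- exact: (cell_weight_children s_gt0 sigma_Ainfty).
- exact: cell_mass_children.
- exact: cell_mass_growth.
- by move=> k m i' S d; apply: cell_weight_Ainfty => //; exact: ltW.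
- exact: c_ge0.
- by move=> k p; exact: integral_ge0.
- move=> p; apply: eq_integral => x _.
  by rewrite /weighted /energy_prod big_geq// mul1e.
- by move=> k p; exact: cell_integral_rec.
- exact: leq0n.
- exact: decay_K.
- exact: cK.
Qed.

(** For these cells the dilate in [cell_integral_le] stays inside the doubled ball, so its weight is
    charged to [wmeas sigma B2]. *)
Let inner : set I := [set i | grid_index s 0 @^-1` near_index 1 i `<=` B2].

(* Far from the ball the potential has no small-scale part, since [nu] lives there. *)
Lemma energy_outside k (x : Rn R n) : eball x0 (2 * r0) x ->
  ~ (grid_index s 0 @^-1` near_index 1 (grid_index s 0 x) `<=` B2) ->
  energy_at k x = 0%R.
Proof.
move=> xB2 xout; rewrite /energy dens_eq0 ?powR0 ?gt_eqF//.
apply: nu_supp; apply/seteqP; split => // y [ky yB] /=; apply: xout => z zx.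
(* Both [y] and [z] lie in cells equal or adjacent to those of [x], so each is within [2 * s] of [x]
   in every coordinate; by [s_small] this keeps [z] in the doubled ball. *)
apply: (eball_near yB (D := (4 * s)%R)) => [t|]; last first.
  by rewrite -lerBrDl (le_trans s_small)//; lra.
have /= := near_index_grid s_gt0 ky t; have := near_index_grid s_gt0 zx t.
have : (side s k <= s)%R.
  by rewrite /side ler_pdivrMr ?exprn_gt0// ler_peMr ?(ltW s_gt0)// exprn_ege1// ler1n.
rewrite (_ : side s 0 = s) => [ks xz xy|]; last by rewrite /side expr0 divr1.
rewrite -(subrKA (tnth x t)) (le_trans (ler_normD _ _))// distrC.
by lra.
Qed.

(** Off the cells of [inner] the product is 1 by [energy_outside], whence the summand [1]. On them
    [cell_integral_le] applies, and each cell is counted at most [3 ^+ n] times as a neighbour. *)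
Lemma integral_energy_prod_le J :
  \int[@lebesgue_Rn R n]_(x in B2) ((energy_prod J 0 x)%:E * sigma x) <=
  (1 + 2 * 3 ^+ n)%:E * wmeas sigma B2.
Proof.
pose G : set (LRn R n) := grid_index s 0 @^-1` inner.
have mG : measurable G by exact: measurable_grid_set.
have mwG : measurable_fun setT (weighted J 0 \_ G).
  by apply/(measurable_restrictT _ mG); exact: measurable_funTS.
have wG0 x : 0 <= (weighted J 0 \_ G) x by exact: erestrict_ge0.
apply: (@le_trans _ _ (\int[@lebesgue_Rn R n]_(x in B2)
    (sigma x + (weighted J 0 \_ G) x))).
  apply: le_integral_nonmeas => x xB2; first exact: weighted_ge0.
  rewrite patchE; case: ifPn => [_|].
    by rewrite leeDr.
  rewrite notin_setE => xG; rewrite adde0 /energy_prod big1 ?mul1e// => l _.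
  by rewrite energy_outside// mulr0 addr0.
rewrite ge0_integralD//; [|exact: measurable_funTS..].
rewrite EFinD ge0_muleDl ?lee_fin ?mulr_ge0 ?exprn_ge0// mul1e; apply: leeD => //.
apply: (@le_trans _ _ (\int[@lebesgue_Rn R n]_(x in setT) (weighted J 0 \_ G) x)).
  by apply: ge0_subset_integral.
rewrite -integral_mkcond /G (@ge0_integral_preimage_esum _ (LRn R n) R I (grid_index s 0))//;
  last by move=> p; exact: measurable_cell_LRn.
pose inner' : set I := [set i | (cell 0 i : set (LRn R n)) `<=` B2].
have w0 := @cell_weight_ge0 R n s Cs theta sigma sigma_Ainfty.
apply: (@le_trans _ _ (\esum_(i in inner) (2%:E * near_sum 1 (cell_weight s sigma 0) i))).
  by apply: le_esum => i _; exact: cell_integral_le.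
rewrite esumZl//; last by move=> i; apply: near_sum_ge0 => p; exact: w0.
rewrite EFinM -muleA; apply: lee_wpmul2l => //.
apply: le_trans (esum_near_sum_le (S' := inner') (w0 0%N) _) _.
  by move=> p p' pin pp' x xp'; apply: pin; rewrite /preimage/= xp'.
rewrite natrX; apply: lee_wpmul2l; first by rewrite lee_fin exprn_ge0.
rewrite -(wmeas_grid_set s_gt0 sigma_Ainfty); apply: (le_wmeas sigma_Ainfty) => //.
  exact: measurable_grid_set.
by move=> x; apply.
Qed.

Definition tail_factor (c0 : R) : R :=
  expR (c0 `^ q * tail_const n alpha q s N V * (1 - kappa^-1 `^ q)^-1).

Variable c0 : R.
Hypothesis c0_ge0 : (0 <= c0)%R.
Hypothesis c0E : (c = 2 * (c0 `^ q * kappa `^ q))%R.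

Let ratio_lt1 : (kappa^-1 `^ q < 1)%R.
Proof. by apply: powRV_lt1 => //; exact: powR2_gt1. Qed.

(** The geometric terms sum up to [tail_factor]. For the others, [c_growth] keeps each exponent
    below [1/2], so [expR_le1D2x] applies; its factor 2 is the one in [c0E]. *)
Lemma expR_partial_energy_le J x :
  (expR (\sum_(k < J) (c0 `^ q * (kappa `^ q * energy_at k.+1 x +
       tail_const n alpha q s N V * (kappa^-1 `^ q) ^+ k))) <=
   tail_factor c0 * energy_prod J 0 x)%R.
Proof.
under eq_bigr do rewrite mulrDr.
rewrite big_split/= expRD mulrC; apply: ler_pM; rewrite ?expR_ge0//.
  rewrite ler_expR -mulrA -mulr_sumr; apply: ler_wpM2l; first exact: powR_ge0.
  rewrite -mulr_sumr; apply: ler_wpM2l; first exact: powR_ge0.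
  rewrite -[leRHS]mul1r.
  have := @geometric_le_lim R J 1 (kappa^-1 `^ q) ler01.
  rewrite powR_gt0 ?invr_gt0// ger0_norm ?powR_ge0// ratio_lt1 => /(_ isT isT).
  apply: le_trans; rewrite /series/= big_mkord; apply: ler_sum => l _.
  by rewrite mul1r.
rewrite expR_sum /energy_prod big_mkord; apply: ler_prod => k _.
rewrite expR_ge0/=; apply: le_trans (expR_le1D2x _ _) _.
- by rewrite !mulr_ge0 ?powR_ge0.
- rewrite mulrA -(@ler_pM2l _ 2%R)// mulrA -c0E mulfV//.
  by apply: le_trans c_growth; apply: ler_wpM2l => //; exact: energy_le.
- by rewrite (mulrA (c0 `^ q)%R) mulrA -c0E.
Qed.

Lemma integral_exp_potential_le :
  \int[@lebesgue_Rn R n]_(x in B2)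
     (expeR ((c0%:E * (potT alpha q nu x / N%:E)) `^ q) * sigma x) <=
  (tail_factor c0 * (1 + 2 * 3 ^+ n))%:E * wmeas sigma B2.
Proof.
pose g J (x : LRn R n) : \bar R := (tail_factor c0)%:E * weighted J 0 x.
have tail0 : (0 <= tail_factor c0)%R by exact: expR_ge0.
have g0 J x : 0 <= g J x by rewrite mule_ge0.
have g_nd x : nondecreasing_seq (g ^~ x).
  apply/nondecreasing_seqP => J; apply: lee_wpmul2l; first by rewrite lee_fin.
  apply: lee_wpmul2r => //; rewrite lee_fin /energy_prod big_nat_recr//=.
  by rewrite ler_peMr ?energy_prod_ge0// lerDl mulr_ge0// energy_ge0.
(* The products increase with [J], each factor being at least 1; monotone convergence then needs
   only the bound of [integral_energy_prod_le], uniform in [J]. *)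
apply: (@le_trans _ _ (\int[@lebesgue_Rn R n]_(x in B2) limn (g ^~ x))).
  apply: le_integral_nonmeas => x _; first by rewrite mule_ge0// expeR_ge0.
  have := potT_le s_gt0 N_gt0 q_gt0 gamma_gt0 nu_growth nu_total x c0_ge0.
  rewrite -lee_expeR => /(lee_wpmul2r (sigma0 x)) /le_trans; apply.
  apply: expeR_nneseries_le => //.
    move=> k; apply: mulr_ge0; first exact: powR_ge0.
    by apply: addr_ge0; apply: mulr_ge0; rewrite ?exprn_ge0 ?powR_ge0.
  move=> J; rewrite (cvg_lim _ (ereal_nondecreasing_cvgn (g_nd x)))//.
  apply: (@le_trans _ _ (g J x)); last by apply: ereal_sup_ubound; exists J.
  rewrite /g muleA -EFinM; apply: lee_wpmul2r => //.
  by rewrite lee_fin expR_partial_energy_le.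
rewrite monotone_convergence//; last first.
  move=> J; apply: emeasurable_funM => //; exact: measurable_funTS.
apply: lime_le.
  apply: ereal_nondecreasing_is_cvgn => J J' JJ'; apply: le_integral_nonmeas => x _ //.
  exact: g_nd.
apply: nearW => J; rewrite ge0_integralZl_EFin//; last exact: measurable_funTS.
rewrite EFinM -muleA; apply: lee_wpmul2l; first by rewrite lee_fin.
exact: integral_energy_prod_le.
Qed.

End exponential_integrability.

(** * Quotients and potentials with degenerate values *)

Section degenerate_cases.
Local Open Scope ereal_scope.
Context {R : realType}.

(** If [W = 0] then [X = 0] and the product is 0 although [W^-1] is infinite; if [W = +oo] the
    inverse is 0. *)
Lemma lee_inve_mull (C : R) (W X : \bar R) : (0 <= C)%R -> 0 <= W -> 0 <= X ->
  X <= C%:E * W -> W^-1 * X <= C%:E.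
Proof.
move=> C0 W0 X0 XW.
have [WE|W_neq0] := eqVneq W 0.
  move: XW; rewrite WE mule0 => XW.
  by rewrite (@le_anti _ _ X 0) ?XW// mule0 lee_fin.
have [->|W_neqy] := eqVneq W +oo; first by rewrite invey mul0e lee_fin.
have Wfin : W \is a fin_num by rewrite ge0_fin_numE// lt_neqAle W_neqy leey.
rewrite -(fineK Wfin) in W0 W_neq0 XW *; move: (fine W) W0 W_neq0 XW => w.
rewrite lee_fin eqe => w0 w_neq0 XW.
have w_gt0 : (0 < w)%R by rewrite lt_def w_neq0.
by rewrite inver (negbTE w_neq0) lee_pdivrMl// muleC.
Qed.

Lemma potT_eq0 n (alpha q : R) (nu : {measure set (Rn R n) -> \bar R}) x :
  (0 < q)%R -> (forall E, measurable E -> nu E = 0) -> potT alpha q nu x = 0.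
Proof.
move=> q0 nu0; rewrite /potT integral0_eq ?poweR0r ?invr_neq0 ?gt_eqF// => r _.
by rewrite nu0 ?mul0e ?poweR0r ?gt_eqF ?mul0e//; exact: measurable_eball.
Qed.

End degenerate_cases.

(** * Choice of the constants and conclusion *)

Theorem theorem1p2 (R : realType) (n : nat) (alpha q Cs theta : R)
    (hn : (1 <= n)%N) (alpha_gt0 : 0 < alpha) (alpha_ltn : alpha < n%:R)
    (q_gt0 : 0 < q) (Cs_gt0 : 0 < Cs) (theta_gt0 : 0 < theta) :
  exists C c : R, 0 < C /\ 0 < c /\
    forall sigma : LRn R n -> \bar R, weak_Ainfty Cs theta sigma ->
    forall mu : {measure set (Rn R n) -> \bar R},
    forall (x0 : Rn R n) (r0 : R), 0 < r0 ->
    let B := eball x0 r0 in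
    let B2 : set (LRn R n) := eball x0 (2 * r0) in
    let muB := mrestr mu (measurable_eball x0 r0) in
    let normM := ('N[@lebesgue_Rn R n]_(+oo) [maxM alpha muB \_ B])%E in
    (normM < +oo ->
     (wmeas sigma B2)^-1 *
       \int[@lebesgue_Rn R n]_(x in B2)
         (expeR ((c%:E * (potT alpha q muB x / normM)) `^ q) * sigma x)
     <= C%:E)%E.
Proof.
pose gamma : R := n%:R - alpha; have gamma_gt0 : 0 < gamma by rewrite subr_gt0.
pose kappa : R := 2 `^ gamma; have kappa_gt0 : 0 < kappa by rewrite powR_gt0.
pose beta : R := 2 `^ (alpha / 2).
have beta_gt1 : 1 < beta by rewrite powR2_gt1// divr_gt0.
pose A := growth_const n alpha.
have A_gt0 : 0 < A by rewrite powR_gt0// mulr_gt0.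
have n_gt0 : 0 < n%:R :> R by rewrite ltr0n.
pose K0 := (1 - beta^-1 `^ q)^-1 +
  A `^ q * Cs * (5 ^+ n * A) `^ theta * (1 - beta^-1 `^ theta)^-1.
have decay_K0 m := sum_decay_le n A m q_gt0 theta_gt0 (ltW Cs_gt0) beta_gt1 : _ <= K0.
have K_gt0 : 0 < K0 + 1.
  by have := decay_K0 0%N; rewrite big_ord0 => /le_lt_trans; apply; rewrite ltrDl.
(* The two bounds are the requirements [cK], with [K0 + 1] for [K], and [c_growth]. *)
pose c := Num.min (2 * 9 ^+ n * (K0 + 1))^-1 (A `^ q)^-1.
have c_gt0 : 0 < c.
  by rewrite lt_min !invr_gt0 powR_gt0// !mulr_gt0// exprn_gt0.
(* Solves [c = 2 * (c0]^ q * kappa [^ q)]. *)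
pose c0 := (c / (2 * kappa `^ q)) `^ q^-1.
have c0q : c0 `^ q = c / (2 * kappa `^ q).
  by rewrite -powRrM mulVf ?gt_eqF// powRr1// divr_ge0 ?(ltW c_gt0)// mulr_ge0 ?powR_ge0.
(* The value of [tail_const] for the mesh [s = r0 / (8 * n)], for which [2 * r0 = 32 * n * (s / 2)]:
   the norm and the radius cancel. *)
pose tau : R := (((2 * n).+1%:R * (32 * n%:R)) `^ gamma) `^ q.
pose M := expR (c0 `^ q * tau * (1 - kappa^-1 `^ q)^-1).
have M_ge1 : 1 <= M.
  rewrite -expR0 ler_expR mulr_ge0 ?mulr_ge0 ?powR_ge0// invr_ge0 subr_ge0 ltW//.
  by rewrite powRV_lt1// powR2_gt1.
exists (M * (1 + 2 * 3 ^+ n)), c0; split.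
  by rewrite mulr_gt0 ?expR_gt0// ltr_wpDr// mulr_ge0// exprn_ge0.
split; first by rewrite powR_gt0// divr_gt0// mulr_gt0// powR_gt0.
move=> sigma sigmaA mu x0 r0 r0_gt0 B B2 muB normM normM_lty.
have growth E D := @mrestr_growth R n alpha mu x0 r0 E D.
have C_ge0 : 0 <= M * (1 + 2 * 3 ^+ n).
  by rewrite mulr_ge0 ?expR_ge0// addr_ge0// mulr_ge0// exprn_ge0.
apply: lee_inve_mull => //.
- exact: wmeas_ge0 sigmaA _.
- by apply: integral_ge0 => x _; rewrite mule_ge0 ?expeR_ge0// (sigma_ge0 sigmaA).
have normM_fin : normM \is a fin_num by rewrite ge0_fin_numE// Lnorm_ge0.
have growthN (E : set (Rn R n)) (D : R) : measurable E -> 0 < D ->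
    (forall y z, E y -> E z -> forall t, `|tnth y t - tnth z t| <= D) ->
    (muB E <= (fine normM * ((2 * n).+1%:R * D) `^ gamma)%:E)%E.
  by move=> mE D0 ED; rewrite EFinM fineK//; exact: growth.
have B_diam y z : B y -> B z -> forall t, `|tnth y t - tnth z t| <= 2 * r0.
  move=> /eball_coord yB /eball_coord zB t; have := yB t; have := zB t.
  by rewrite !ltr_norml ler_norml => /andP[? ?] /andP[? ?]; apply/andP; split; lra.
have muB_total : (muB setT <= (fine normM * ((2 * n).+1%:R * (2 * r0)) `^ gamma)%:E)%E.
  have -> : muB setT = muB B by rewrite /muB /mrestr setTI setIid.
  by apply: growthN => //; [exact: measurable_eball|rewrite mulr_gt0].
have : 0 <= fine normM by rewrite fine_ge0// Lnorm_ge0.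
rewrite le_eqVlt => /predU1P[N0|N_gt0].
  (* A vanishing norm makes [muB] vanish by the growth bound; the potential is then 0, its quotient
     by the norm is 0, and the exponential is 1. *)
  have muB0 E : measurable E -> muB E = 0.
    move=> mE; apply/eqP; rewrite eq_le measure_ge0 andbT.
    apply: (@le_trans _ _ (muB setT)); first by apply: le_measure; rewrite ?inE.
    by move: muB_total; rewrite -N0 mul0r.
  rewrite (eq_integral sigma) => [|x _]; last first.
    by rewrite potT_eq0// mul0e mule0 poweR0r ?gt_eqF// expeR0 mul1e.
  rewrite -[leLHS]mul1e; apply: lee_wpmul2r; first exact: wmeas_ge0 sigmaA _.
  rewrite lee_fin -[leLHS]mulr1; apply: ler_pM => //.
  by rewrite lerDl mulr_ge0// exprn_ge0.
(* This mesh gives [n * (4 * s) = r0 / 2], within the bound [s_small]. *)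
pose s := r0 / (8 * n%:R).
have s_gt0 : 0 < s by rewrite divr_gt0// mulr_gt0.
have tauE : tail_const n alpha q s (fine normM)
    (fine normM * ((2 * n).+1%:R * (2 * r0)) `^ gamma) = tau.
  rewrite /tail_const /tau -/gamma; congr (_ `^ _).
  have -> : (2 * n).+1%:R * (2 * r0) = (2 * n).+1%:R * (32 * n%:R) * (s / 2) :> R.
    by rewrite /s; field; rewrite gt_eqF.
  rewrite powRM ?mulr_ge0 ?divr_ge0 ?(ltW r0_gt0) ?(ltW n_gt0)//.
  by field; rewrite !gt_eqF// powR_gt0// divr_gt0.
rewrite -(fineK normM_fin) /M -tauE.
apply: (@integral_exp_potential_le R n alpha q s (fine normM) _ Cs theta x0 r0 muB sigma
  s_gt0 N_gt0 q_gt0 alpha_gt0 gamma_gt0 Cs_gt0 theta_gt0 growthN muB_total _ sigmaA _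
  c (K0 + 1) (ltW c_gt0) _ _ _ c0 _ _).
- by move=> E E0; change (mu (E `&` eball x0 r0) = 0); rewrite E0 measure0.
- have -> : n%:R * (4 * s) = r0 / 2 :> R by rewrite /s; field; rewrite gt_eqF.
  by lra.
- by move=> m; rewrite (le_trans (decay_K0 m))// lerDl.
- rewrite [leLHS](_ : _ = c * (2 * 9 ^+ n * (K0 + 1))); last by ring.
  by rewrite -ler_pdivlMr ?div1r ?ge_min ?lexx// !mulr_gt0// exprn_gt0.
- by rewrite -ler_pdivlMr ?div1r ?ge_min ?lexx ?orbT// powR_gt0.
- exact: powR_ge0.
- by rewrite c0q; field; rewrite gt_eqF// powR_gt0.
Qed.
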